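(* Let $Y,Y_1,Y_2,\dots$ be i.i.d. real random variables such that $a=\inf\{s<0:\mathbb{E}[e^{sY}]<\infty\}<0$ and $b=\sup\{s>0:\mathbb{E}[e^{sY}]<\infty\}>0$. Let $\mu=\mathbb{E}[Y]$, $\sigma^2=\mathbb{E}[|Y-\mu|^2]$, $\nu=\mathbb{E}[(Y-\mu)^3]$, and assume $\sigma>0$. Let $\varphi(s)=\ln\mathbb{E}[e^{s(Y-\mu)}]$ for $s\in(a,b)$, and $X_n=\sum_{i=1}^n(Y_i-\mu)$ for $n\in\mathbb{N}$. Then for every positive integer $m$ and every real $\varepsilon$ with $\lim_{s\downarrow a}\frac{\varphi(s)}{s}<\varepsilon<\lim_{s\uparrow b}\frac{\varphi(s)}{s}$: (i) for all $s\in(a,b)$, \[ \Pr\Big\{\sup_{n\in\mathbb{N}}\big[s(X_n-m\varepsilon)-\varphi(s)(n-m)\big]\ge0\Big\}\le\big[\exp(\varphi(s)-\varepsilon s)\big]^m; \] (ii) the equation $\varphi'(s)=\varepsilon$ has a unique root $\zeta$ in $(a,b)$, and \[ \Pr\Big\{\sup_{n\in\mathbb{N}}\big[\zeta(X_n-m\varepsilon)-\varphi(\zeta)(n-m)\big]\ge0\Big\}\le\big[\exp(\varphi(\zeta)-\varepsilon\zeta)\big]^m; \] (iii) as $\varepsilon\to0$ (with $m$ fixed), \[ \big[\exp(\varphi(\zeta)-\varepsilon\zeta)\big]^m=[1+O(\varepsilon^4)]\Big[\exp\Big(-\frac{\varepsilon^2}{2\sigma^2}+\frac{\nu\varepsilon^3}{6\sigma^6}\Big)\Big]^m=[1+O(\varepsilon^3)]\Big[\exp\Big(-\frac{\varepsilon^2}{2\sigma^2}\Big)\Big]^m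 \] and \[ \frac{\varphi(\zeta)}{\zeta}=\frac{\varepsilon}{2}\Big[1-\frac{\nu\varepsilon}{6\sigma^4}+O(\varepsilon^2)\Big]=\frac{\varepsilon}{2}[1+O(\varepsilon)]. \]
   Context: $\mathbb{N}$ denotes the set of positive integers. $f(x)=O(g(x))$ as $x\to a$ means $\limsup_{x\to a}|f(x)/g(x)|<\infty$; an expression $1+O(\varepsilon^j)$ denotes $1+h(\varepsilon)$ with $h(\varepsilon)=O(\varepsilon^j)$. Here $\zeta=\zeta(\varepsilon)$ depends on $\varepsilon$, and the ratio $\varphi(\zeta)/\zeta$ is considered for $\varepsilon\neq0$. *)

(* Defs.v *)
From HB Require Import structures.
From mathcomp Require Import all_boot all_order all_algebra.
From mathcomp Require Import all_classical all_reals all_analysis.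
Set Implicit Arguments. Unset Strict Implicit. Unset Printing Implicit Defensive.
Import Order.TTheory GRing.Theory Num.Theory.
Import numFieldNormedType.Exports.
Local Open Scope classical_set_scope.
Local Open Scope ring_scope.

Definition mutually_independent_rv (d : measure_display) (T : measurableType d)
  (R : realType) (P : probability T R) (Xs : nat -> {RV P >-> R}) : Prop :=
  forall (s : seq nat) (B : nat -> set R), uniq s ->
    (forall i, measurable (B i)) ->
    P (\big[setI/setT]_(i <- s) (Xs i @^-1` B i)) =
    (\prod_(i <- s) P (Xs i @^-1` B i))%E.

Definition identically_distributed (d : measure_display) (T : measurableType d)
  (R : realType) (P : probability T R) (X Y : {RV P >-> R}) : Prop :=
  forall B : set R, measurable B -> P (X @^-1` B) = P (Y @^-1` B).

Definition mgf (d : measure_display) (T : measurableType d)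
  (R : realType) (P : probability T R) (Y : {RV P >-> R}) (s : R) : \bar R :=
  (\int[P]_x (expR (s * Y x))%:E)%E.

Definition mgf_lo (d : measure_display) (T : measurableType d)
  (R : realType) (P : probability T R) (Y : {RV P >-> R}) : \bar R :=
  ereal_inf [set s%:E | s in [set s : R | s < 0 /\ (mgf Y s < +oo)%E]].
Definition mgf_hi (d : measure_display) (T : measurableType d)
  (R : realType) (P : probability T R) (Y : {RV P >-> R}) : \bar R :=
  ereal_sup [set s%:E | s in [set s : R | 0 < s /\ (mgf Y s < +oo)%E]].

Definition mean (d : measure_display) (T : measurableType d)
  (R : realType) (P : probability T R) (Y : {RV P >-> R}) : R := fine 'E_P[Y].
Definition var (d : measure_display) (T : measurableType d)
  (R : realType) (P : probability T R) (Y : {RV P >-> R}) : R :=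
  fine (\int[P]_x (`|Y x - mean Y| ^+ 2)%:E)%E.
Definition sd (d : measure_display) (T : measurableType d)
  (R : realType) (P : probability T R) (Y : {RV P >-> R}) : R := Num.sqrt (var Y).
Definition third_cmoment (d : measure_display) (T : measurableType d)
  (R : realType) (P : probability T R) (Y : {RV P >-> R}) : R :=
  fine (\int[P]_x ((Y x - mean Y) ^+ 3)%:E)%E.

(* phi(s) = ln E[e^{s(Y - mu)}]  (meaningful for s in (a,b)) *)
Definition cgf (d : measure_display) (T : measurableType d)
  (R : realType) (P : probability T R) (Y : {RV P >-> R}) (s : R) : R :=
  ln (fine (\int[P]_x (expR (s * (Y x - mean Y)))%:E)%E).

(* X_n = sum_{i=1}^n (Y_i - mu); the family Y_1, Y_2, ... is Ys 0, Ys 1, ... *)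
Definition centered_sum (d : measure_display) (T : measurableType d)
  (R : realType) (P : probability T R) (Ys : nat -> {RV P >-> R}) (mu : R)
  (n : nat) (x : T) : R :=
  \sum_(i < n) (Ys i x - mu).

Definition right_of (R : realType) (a : \bar R) : set_system R :=
  match a with
  | EFin x => x^'+
  | -oo%E => ninfty_nbhs R
  | +oo%E => pinfty_nbhs R
  end.
Definition left_of (R : realType) (b : \bar R) : set_system R :=
  match b with
  | EFin x => x^'-
  | +oo%E => pinfty_nbhs R
  | -oo%E => ninfty_nbhs R
  end.

(* Main.v *)
Require Import Defs.
From HB Require Import structures.
From mathcomp Require Import all_boot all_order all_algebra.
From mathcomp Require Import all_classical all_reals all_analysis.
From mathcomp Require Import measurable_realfun.
From mathcomp Require Import ring lra.
Import Order.TTheory GRing.Theory Num.Theory.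
Import numFieldNormedType.Exports.
Set Implicit Arguments.
Unset Strict Implicit.
Unset Printing Implicit Defensive.
Local Open Scope classical_set_scope.
Local Open Scope ring_scope.

(* For fixed s, M_n = exp (s X_n - n phi(s)) is a product of independent
   factors of mean 1, and the event in (i) says that sup_n M_n reaches
   exp (m (s eps - phi(s))), so (i) is Ville's inequality. It is obtained by
   freezing the product once it has crossed the level c: the frozen product
   still has mean 1, and Markov's inequality applies to it.
   For (ii), phi(s) - eps s vanishes at 0 and is positive near both endpoints,
   hence has an interior minimum. With Z = Y - mu, if phi'(s) = eps and s < t,
   then (Z - eps) (exp (t (Z - eps)) - exp (s (Z - eps))) is nonnegative and not
   a.s. 0; taking means gives phi'(t) > eps, so phi' is strictly increasing.
   For (iii), integrating the Taylor remainders of exp gives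
   phi(s) = sigma^2 s^2 / 2 + nu s^3 / 6 + O(s^4) and
   phi'(s) = sigma^2 s + nu s^2 / 2 + O(s^3); inverting the latter,
   zeta = eps / sigma^2 - nu eps^2 / (2 sigma^6) + O(eps^3). *)

(** * Independence and Ville's inequality *)

Section Independence.
Context (d : measure_display) (T : measurableType d) (R : realType)
  (P : probability T R).

(** The joint law of [(Z, W)] agrees with the product of the two laws on rectangles, hence
    everywhere, and Tonelli separates the integral. The target types are arbitrary so that [Z] can
    be a whole past rather than a real variable. *)
Lemma integral_mul_independent d1 d2 (T1 : measurableType d1)
    (T2 : measurableType d2) (Z : {mfun T >-> T1}) (W : {mfun T >-> T2})
    (g : T1 -> R) (h : T2 -> R) :
  measurable_fun setT g -> measurable_fun setT h ->
  (forall x, 0 <= g x) -> (forall y, 0 <= h y) ->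
  (forall A B, measurable A -> measurable B ->
     P (Z @^-1` A `&` W @^-1` B) = (P (Z @^-1` A) * P (W @^-1` B))%E) ->
  (\int[P]_x (g (Z x) * h (W x))%:E =
   \int[P]_x (g (Z x))%:E * \int[P]_x (h (W x))%:E)%E.
Proof.
move=> mg mh g0 h0 ZW.
have mZW : measurable_fun setT (fun x => (Z x, W x)) by exact/measurable_fun_pair.
pose ZWm : {mfun T >-> (T1 * T2)%type} := HB.pack (fun x => (Z x, W x))
  (isMeasurableFun.Build _ _ _ _ _ mZW).
pose m1 := distribution P Z; pose m2 := distribution P W.
have joint (X : set (T1 * T2)) : measurable X ->
    (m1 \x m2)%E X = distribution P ZWm X.
  by apply: product_measure_unique => A B mA mB; exact: ZW.
pose f (p : T1 * T2) : \bar R := (g p.1 * h p.2)%:E.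
have mf : measurable_fun setT f.
  by apply/measurable_EFinP; apply: measurable_funM; exact: measurableT_comp.
have f0 p : (0 <= f p)%E by rewrite lee_fin mulr_ge0.
have -> : (\int[P]_x (g (Z x) * h (W x))%:E =
           \int[distribution P ZWm]_p f p)%E.
  by rewrite ge0_integral_distribution.
rewrite (eq_measure_integral (m1 \x m2)%E); last by move=> A mA _; exact/esym/joint.
rewrite fubini_tonelli1// /fubini_F /=.
have -> : (\int[P]_x (g (Z x))%:E = \int[m1]_y (g y)%:E)%E.
  rewrite ge0_integral_distribution//; exact/measurable_EFinP.
have -> : (\int[P]_x (h (W x))%:E = \int[m2]_y (h y)%:E)%E.
  rewrite ge0_integral_distribution//; exact/measurable_EFinP.
rewrite -ge0_integralZr//; last 3 first.
- exact/measurable_EFinP.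
- by move=> x _; rewrite lee_fin.
- by apply: integral_ge0 => y _; rewrite lee_fin.
apply: eq_integral => x _; rewrite -ge0_integralZl//.
- exact/measurable_EFinP.
- by move=> y _; rewrite lee_fin.
- by rewrite lee_fin.
Qed.

Variable Ys : nat -> {RV P >-> R}.

(** A pi-system generating the sigma-algebra of the first [k] variables; [g_sigma_algebraType]
    equips [T] itself with that coarser sigma-algebra. *)
Definition past_cylinders (k : nat) : set (set T) :=
  [set A | exists2 B : nat -> set R, (forall i, measurable (B i)) &
     A = \big[setI/setT]_(i <- iota 0 k) (Ys i @^-1` B i)].

Lemma measurable_past_cylinder k : past_cylinders k `<=` measurable.
Proof.
move=> A [B mB ->]; apply: bigsetI_measurable => i _.
by rewrite -[X in measurable X]setTI; exact: measurable_funP.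
Qed.

Lemma past_cylinders_setI k : setI_closed (past_cylinders k).
Proof.
move=> A A' [B mB ->] [B' mB' ->]; exists (fun i => B i `&` B' i).
  by move=> i; exact: measurableI.
by rewrite -big_split/=; apply: eq_bigr => i _; rewrite preimage_setI.
Qed.

Lemma measurable_past k i : (i < k)%N ->
  measurable_fun [set: g_sigma_algebraType (past_cylinders k)] (Ys i).
Proof.
move=> ik _ B mB; rewrite setTI; apply: sub_sigma_algebra.
exists (fun j => if j == i then B else setT); first by move=> j; case: ifP.
rewrite (bigD1_seq i) ?iota_uniq ?mem_iota//= eqxx big1 ?setIT// => j.
by move/negbTE => ->.
Qed.

Hypothesis indep : mutually_independent_rv Ys.

(** As functions of [A], both sides are finite measures: a restriction and a multiple of [P]. They
    agree on the cylinders, which are closed under intersection, hence on the generated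
    sigma-algebra. *)
Lemma past_independent k A B : <<s past_cylinders k >> A -> measurable B ->
  P (A `&` Ys k @^-1` B) = (P A * P (Ys k @^-1` B))%E.
Proof.
move=> FA mB.
have mYB : measurable (Ys k @^-1` B).
  by rewrite -[X in measurable X]setTI; exact: measurable_funP.
have PYB : P (Ys k @^-1` B) \is a fin_num by exact: fin_num_measure.
pose r : {nonneg R} := NngNum (fine_ge0 (measure_ge0 P (Ys k @^-1` B))).
rewrite muleC -(fineK PYB).
change (mrestr P mYB A = mscale r P A).
apply: (g_sigma_algebra_measure_unique (past_cylinders k)
  (@measurable_past_cylinder k) (fun=> setT)) => //.
- move=> _; exists (fun=> setT) => //.
  by rewrite big1.
- by apply/seteqP; split => // x _; exists 0%N.
- exact: past_cylinders_setI.
- move=> D [C mC ->{D}]; set D := \big[_/_]_(i <- _) _.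
  change (P (D `&` Ys k @^-1` B) = (fine (P (Ys k @^-1` B)))%:E * P D)%E.
  rewrite fineK// muleC {}/D.
  (* Placing [B] at index [k] turns the intersection into a single cylinder over [k.+1] indices, to
     which [indep] applies. *)
  pose C' i := if i == k then B else C i.
  have CE i : i \in iota 0 k -> C' i = C i.
    by rewrite mem_iota add0n /C' => /= ik; rewrite ltn_eqF.
  have mC' i : measurable (C' i) by rewrite /C'; case: ifP.
  have uk : uniq (rcons (iota 0 k) k).
    by rewrite rcons_uniq iota_uniq mem_iota ltnn andbF.
  have := @indep _ _ uk mC'.
  rewrite -cats1 !big_cat/= !big_seq1 {2 4}/C' eqxx.
  rewrite (eq_big_seq (fun i => Ys i @^-1` C i)); last by move=> i /CE ->.
  rewrite (eq_big_seq (fun i => P (Ys i @^-1` C i))); last by move=> i /CE ->.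
  by move=> ->; rewrite (@indep _ _ (iota_uniq 0 k) mC).
- move=> _; change (P (setT `&` Ys k @^-1` B) < +oo)%E.
  by rewrite setTI ltey_eq PYB.
Qed.

End Independence.

(** * Ville's inequality for products of independent factors of mean 1 *)

Section Ville.
Context (d : measure_display) (T : measurableType d) (R : realType)
  (P : probability T R) (Ys : nat -> {RV P >-> R}) (f : R -> R) (c : R).
Hypothesis indep : mutually_independent_rv Ys.
Hypotheses (mf : measurable_fun setT f) (f0 : forall y, 0 <= f y).
Hypothesis Ef : forall i, (\int[P]_x (f (Ys i x))%:E = 1)%E.
Hypothesis c0 : 0 < c.

(** The product martingale stopped on first reaching [c], written recursively so that no stopping
    time has to be introduced. *)
Fixpoint stopped_prod (k : nat) (x : T) : R :=
  if k is k'.+1 then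
    if c <= stopped_prod k' x then stopped_prod k' x
    else stopped_prod k' x * f (Ys k' x)
  else 1.

Lemma stopped_prod_ge0 k x : 0 <= stopped_prod k x.
Proof. by elim: k => //= k IH; case: ifP => // _; exact: mulr_ge0. Qed.

Lemma past_measurable_stopped_prod k n : (k <= n)%N ->
  measurable_fun [set: g_sigma_algebraType (past_cylinders Ys n)]
    (stopped_prod k).
Proof.
elim: k => [|k IH] kn /=; first exact: measurable_cst.
have mS := IH (ltnW kn).
apply: measurable_fun_ifT => //; first by apply: measurable_fun_ler.
by apply: measurable_funM => //; apply: measurableT_comp => //;
  exact: measurable_past.
Qed.

Lemma past_sub_measurable n (A : set T) :
  measurable (A : set (g_sigma_algebraType (past_cylinders Ys n))) ->
  measurable A.
Proof.
apply: smallest_sub; first exact: sigma_algebra_measurable.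
exact: measurable_past_cylinder.
Qed.

Lemma past_measurable_fun n (g : T -> R) :
  measurable_fun [set: g_sigma_algebraType (past_cylinders Ys n)] g ->
  measurable_fun setT g.
Proof.
move=> mg _ B mB; apply: (@past_sub_measurable n).
by apply: mg.
Qed.

(** In one step, the part already frozen ([V]) is untouched, while the running part ([Z]) depends on
    the past only and is multiplied by an independent factor of mean 1. *)
Lemma integral_stopped_prod k : (\int[P]_x (stopped_prod k x)%:E = 1)%E.
Proof.
elim: k => [|k IH] /=.
  by rewrite integral_cst//= mul1e probability_setT.
have mS := @past_measurable_stopped_prod k k (leqnn k).
pose Z x := if c <= stopped_prod k x then 0 else stopped_prod k x.
pose V x := if c <= stopped_prod k x then stopped_prod k x else 0.
have Z0 x : 0 <= Z x by rewrite /Z; case: ifP => // _; exact: stopped_prod_ge0.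
have V0 x : 0 <= V x by rewrite /V; case: ifP => // _; exact: stopped_prod_ge0.
have mZ : measurable_fun [set: g_sigma_algebraType (past_cylinders Ys k)] Z.
  by apply: measurable_fun_ifT => //; apply: measurable_fun_ler.
have mV : measurable_fun [set: g_sigma_algebraType (past_cylinders Ys k)] V.
  by apply: measurable_fun_ifT => //; apply: measurable_fun_ler.
have mZT := past_measurable_fun mZ; have mVT := past_measurable_fun mV.
have mid : measurable_fun [set: T]
    (id : T -> g_sigma_algebraType (past_cylinders Ys k)).
  by move=> _ A mA; rewrite setTI; exact: past_sub_measurable mA.
have EZf : (\int[P]_x (Z x * f (Ys k x))%:E = \int[P]_x (Z x)%:E)%E.
  (* The identity of [T], read as a map into the coarser sigma-algebra, plays the role of the whole
     past. *)
  pose pastm : {mfun T >-> g_sigma_algebraType (past_cylinders Ys k)} :=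
    HB.pack (id : T -> g_sigma_algebraType (past_cylinders Ys k))
      (isMeasurableFun.Build _ _ _ _ _ mid).
  rewrite (@integral_mul_independent _ _ _ _ _ _ _ _ pastm (Ys k) Z f)//.
    by rewrite Ef mule1.
  by move=> A B mA mB; exact: past_independent.
rewrite -IH.
transitivity (\int[P]_x ((V x)%:E + (Z x * f (Ys k x))%:E))%E.
  apply: eq_integral => x _; rewrite -EFinD /V /Z; case: ifP => _.
    by rewrite mul0r addr0.
  by rewrite add0r.
have mfY : measurable_fun setT (fun x => f (Ys k x)) by exact: measurableT_comp.
have mVE := (measurable_EFinP _ _).2 mVT.
have mZE := (measurable_EFinP _ _).2 mZT.
have mZfE := (measurable_EFinP _ _).2 (measurable_funM mZT mfY).
rewrite ge0_integralD//; last 2 first.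
- by move=> x _; rewrite lee_fin.
- by move=> x _; rewrite lee_fin mulr_ge0.
rewrite EZf -ge0_integralD//; last 2 first.
- by move=> x _; rewrite lee_fin.
- by move=> x _; rewrite lee_fin.
apply: eq_integral => x _; rewrite -EFinD /V /Z; case: ifP => _.
  by rewrite addr0.
by rewrite add0r.
Qed.

Lemma stopped_prod_crossing n x :
  c <= \prod_(i < n) f (Ys i x) -> c <= stopped_prod n x.
Proof.
have keep k m : (k <= m)%N -> c <= stopped_prod k x -> c <= stopped_prod m x.
  move=> /subnKC <-; elim: (m - k)%N => [|j IH] cS; first by rewrite addn0.
  by rewrite addnS /= IH// IH.
have [[k kn cSk] _|noc] := pselect (exists2 k, (k <= n)%N & c <= stopped_prod k x).
  exact: keep cSk.
suff SE k : (k <= n)%N -> stopped_prod k x = \prod_(i < k) f (Ys i x).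
  by rewrite SE.
elim: k => [|k IH] kn /=; first by rewrite big_ord0.
rewrite big_ord_recr /= -IH ?(ltnW kn)//; case: ifP => // cS.
by exfalso; apply: noc; exists k => //; exact: ltnW.
Qed.

(** Markov bounds each [E n]; freezing makes these events increase with [n], so continuity from
    below carries the bound to their union, which contains [A]. *)
Lemma ville_ge (A : set T) : measurable A ->
  A `<=` [set x | exists n, c <= \prod_(i < n) f (Ys i x)] ->
  (P A <= c^-1%:E)%E.
Proof.
move=> mA Asub.
pose E n := [set x | c <= stopped_prod n x].
have mS n : measurable_fun setT (stopped_prod n).
  exact: (past_measurable_fun (@past_measurable_stopped_prod n n (leqnn n))).
have mE n : measurable (E n).
  rewrite -[X in measurable X]setTI.
  have -> : E n = (fun x => c <= stopped_prod n x) @^-1` [set true] by [].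
  exact: (measurable_fun_ler (measurable_cst c) (mS n)).
have PE n : (P (E n) <= c^-1%:E)%E.
  have : (c%:E * P (E n) <= 1)%E.
    rewrite -(integral_stopped_prod n) -integral_cst//.
    apply: (@le_trans _ _ (\int[P]_(x in E n) (stopped_prod n x)%:E)%E).
      apply: ge0_le_integral => //.
      - by move=> x _; rewrite lee_fin ltW.
      - apply/measurable_EFinP; exact: measurable_funS (mS n).
    apply: ge0_subset_integral => //; first exact/measurable_EFinP.
    by move=> x _; rewrite lee_fin stopped_prod_ge0.
  have PEf : P (E n) \is a fin_num by exact: fin_num_measure.
  by rewrite -(fineK PEf) -EFinM !lee_fin -[_^-1]mulr1 ler_pdivlMl.
have ndE : nondecreasing_seq E.
  apply/nondecreasing_seqP => n; apply/subsetPset => x; rewrite /E /= => cS.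
  by rewrite cS.
have mUE : measurable (\bigcup_n E n) by exact: bigcupT_measurable.
apply: (@le_trans _ _ (P (\bigcup_n E n))).
  apply: le_measure; rewrite ?inE// => x /Asub [n cn]; exists n => //.
  exact: stopped_prod_crossing.
have cv := nondecreasing_cvg_mu (mu := P) mE mUE ndE.
rewrite -(cvg_lim _ cv)//; apply: lime_le.
  by apply/cvg_ex; exists (P (\bigcup_n E n)).
by apply: nearW => n; exact: PE.
Qed.

End Ville.

(** * Exponential moments *)

Section ExpBounds.
Context (R : realType).
Implicit Types (F G : R -> R) (x y z u : R) (k : nat).

(** By the mean value theorem [F y = G c * y] with [|c| <= |y|]. Each integration adds one power and
    keeps the exponential factor, so the Taylor bounds below follow one from another, at the price
    of the factorials. *)
Lemma antiderivative_bound F G k y :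
  (forall x, is_derive x 1 F (G x)) -> F 0 = 0 ->
  (forall x, `|G x| <= `|x| ^+ k * expR `|x|) ->
  `|F y| <= `|y| ^+ k.+1 * expR `|y|.
Proof.
move=> dF F0 Gle.
have cF a b : {within `[a, b], continuous F}.
  apply: derivable_within_continuous => x _.
  by have [] := dF x.
suff [c cy Fy] : exists2 c, `|c| <= `|y| & F y = G c * y.
  rewrite Fy normrM exprS -mulrA mulrC ler_wpM2l//.
  rewrite (le_trans (Gle c))// ler_pM ?exprn_ge0 ?expR_ge0//.
    by rewrite lerXn2r ?nnegrE.
  by rewrite ler_expR.
have [y0|y0] := leP 0 y.
  have [c] := MVT_segment y0 (fun x _ => dF x) (cF 0 y).
  rewrite in_itv/= F0 !subr0 => /andP[c0 cy] ->; exists c => //.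
  by rewrite !ger0_norm.
have [c] := MVT_segment (ltW y0) (fun x _ => dF x) (cF y 0).
rewrite in_itv/= F0 !sub0r => /andP[yc c0] /eqP; rewrite mulrN eqr_opp.
move=> /eqP ->; exists c => //.
by rewrite (ltr0_norm y0) ler0_norm// lerN2.
Qed.

Lemma expR_taylor0 y : `|expR y| <= `|y| ^+ 0 * expR `|y|.
Proof. by rewrite expr0 mul1r ger0_norm ?expR_ge0// ler_expR ler_norm. Qed.

Lemma expR_taylor1 y : `|expR y - 1| <= `|y| ^+ 1 * expR `|y|.
Proof.
apply: (@antiderivative_bound (fun y => expR y - 1) expR).
- by move=> x; apply: is_derive_eq; rewrite subr0.
- by rewrite expR0 subrr.
- exact: expR_taylor0.
Qed.

Lemma expR_taylor2 y : `|expR y - 1 - y| <= `|y| ^+ 2 * expR `|y|.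
Proof.
apply: (@antiderivative_bound (fun y => expR y - 1 - y) (fun y => expR y - 1)).
- by move=> x; apply: is_derive_eq; rewrite subr0.
- by rewrite expR0 subrr subr0.
- exact: expR_taylor1.
Qed.

Lemma expR_taylor3 y :
  `|expR y - 1 - y - y ^+ 2 / 2| <= `|y| ^+ 3 * expR `|y|.
Proof.
apply: (@antiderivative_bound (fun y => expR y - 1 - y - y ^+ 2 / 2)
  (fun y => expR y - 1 - y)).
- by move=> x; apply: is_derive_eq; rewrite /GRing.scale /=; field.
- by rewrite expR0; lra.
- exact: expR_taylor2.
Qed.

Lemma expR_taylor4 y :
  `|expR y - 1 - y - y ^+ 2 / 2 - y ^+ 3 / 6| <= `|y| ^+ 4 * expR `|y|.
Proof.
apply: (@antiderivative_bound
  (fun y => expR y - 1 - y - y ^+ 2 / 2 - y ^+ 3 / 6)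
  (fun y => expR y - 1 - y - y ^+ 2 / 2)).
- by move=> x; apply: is_derive_eq; rewrite /GRing.scale /=; field.
- by rewrite expR0; lra.
- exact: expR_taylor3.
Qed.

Lemma expR_norm_le z : expR `|z| <= expR z + expR (- z).
Proof.
by have [z0|z0] := leP 0 z;
  rewrite ?(ger0_norm z0) ?(ltr0_norm z0) (lerDl, lerDr) expR_ge0.
Qed.

(** [(e |z|)^k / k!] is one term of the series of [exp (e |z|)], and [expR_norm_le] removes the
    absolute value. A polynomial factor thus costs only a shift of [u] by [e] either way. *)
Lemma norm_exp_mul_expR_le k u e z : 0 < e ->
  `|z| ^+ k * expR (u * z) <=
  k`!%:R / e ^+ k * (expR ((u + e) * z) + expR ((u - e) * z)).
Proof.
move=> e0.
have ek0 : 0 < e ^+ k by rewrite exprn_gt0.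
have f0 : 0 < k`!%:R :> R by rewrite ltr0n fact_gt0.
have le1 : (e * `|z|) ^+ k / k`!%:R <= expR (e * `|z|).
  have ez : 0 <= e * `|z| by rewrite mulr_ge0// ltW.
  case: k {ek0 f0} => [|k].
    by rewrite expr0 fact0 divr1 -expR0 ler_expR.
  by apply: le_trans (expR_ge1Dxn k ez); rewrite lerDr.
have -> : `|z| ^+ k = k`!%:R / e ^+ k * ((e * `|z|) ^+ k / k`!%:R).
  by rewrite exprMn; field; rewrite !gt_eqF.
rewrite -[leLHS]mulrA ler_wpM2l//; first by rewrite divr_ge0// ltW.
apply: (@le_trans _ _ (expR (e * `|z|) * expR (u * z))).
  by rewrite ler_wpM2r// expR_ge0.
have -> : e * `|z| = `|e * z| by rewrite normrM (gtr0_norm e0).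
apply: (@le_trans _ _ ((expR (e * z) + expR (- (e * z))) * expR (u * z))).
  by rewrite ler_wpM2r ?expR_ge0// expR_norm_le.
rewrite mulrDl -!expRD (_ : e * z + u * z = (u + e) * z); last by ring.
by rewrite (_ : - (e * z) + u * z = (u - e) * z)//; ring.
Qed.

End ExpBounds.

(** This quantitative criterion replaces dominated convergence when differentiating under the
    integral. *)
Lemma is_derive_quadratic (R : realType) (f : R -> R) (u l C e : R) :
  0 < e ->
  (forall h, `|h| < e -> `|f (u + h) - f u - h * l| <= C * h ^+ 2) ->
  is_derive u 1 f l.
Proof.
move=> e0 fC.
have C0 : 0 <= C.
  have := fC (e / 2); rewrite ger0_norm; last by lra.
  move=> /(_ _)/(le_trans (normr_ge0 _)) => /(_ ltac:(lra)).
  by rewrite pmulr_lge0// exprn_gt0//; lra.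
have cv : h^-1 *: ((f \o shift u) (h *: (1 : R)) - f u) @[h --> (0 : R)^'] --> l.
  apply/cvgrPdist_le => eps eps0; near=> h.
  have h0 : h != 0 by near: h; exact: nbhs_dnbhs_neq.
  have he : `|h| < e.
    by near: h; apply: dnbhs0_lt.
  (* [C + 1] rather than [C], since [C] may be 0. *)
  have hC : `|h| < eps / (C + 1).
    by near: h; apply: dnbhs0_lt; rewrite divr_gt0//; lra.
  rewrite /= [_ *: 1]mulr1 [h + u]addrC.
  have -> : l - h^-1 *: (f (u + h) - f u) = - (h^-1 * (f (u + h) - f u - h * l)).
    by rewrite /GRing.scale /=; field.
  rewrite normrN normrM normfV mulrC ler_pdivrMr ?normr_gt0//.
  apply: (le_trans (fC _ he)); rewrite -normr_id -(ger0_norm (sqr_ge0 h)) normrX.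
  rewrite expr2 mulrA normr_id ler_wpM2r//.
  move: hC; rewrite ltr_pdivlMr; last by lra.
  have := normr_ge0 h; nra.
apply: DeriveDef; first by apply/cvg_ex; exists l.
exact/cvg_lim.
Unshelve. all: by end_near. Qed.

(** * Real-valued integrals against a probability *)

Section RealIntegral.
Context (d : measure_display) (T : measurableType d) (R : realType)
  (P : probability T R).
Implicit Types f g : T -> R.

Definition rintegrable f := P.-integrable setT (EFin \o f).

Lemma rintegrable_le f g : measurable_fun setT f -> rintegrable g ->
  (forall x, `|f x| <= g x) -> rintegrable f.
Proof.
move=> mf ig fg; apply: le_integrable ig => //; first exact/measurable_EFinP.
by move=> x _; rewrite !lee_fin (le_trans (fg x))// ler_norm.
Qed.

Lemma rintegrableD f g : rintegrable f -> rintegrable g ->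
  rintegrable (fun x => f x + g x).
Proof. by move=> fi gi; have := integrableD measurableT fi gi. Qed.

Lemma rintegrableB f g : rintegrable f -> rintegrable g ->
  rintegrable (fun x => f x - g x).
Proof. by move=> fi gi; have := integrableB measurableT fi gi. Qed.

Lemma rintegrableZ (k : R) f : rintegrable f -> rintegrable (fun x => k * f x).
Proof. by move=> fi; have := integrableZl measurableT k fi. Qed.

Lemma rintegrable_cst (k : R) : rintegrable (fun=> k).
Proof. exact: finite_measure_integrable_cst. Qed.

Lemma norm_Rintegral_le f g : rintegrable f -> rintegrable g ->
  (forall x, `|f x| <= g x) ->
  `|\int[P]_x f x| <= \int[P]_x g x.
Proof.
move=> fi gi fg; apply: (le_trans (le_normr_Rintegral measurableT fi)).
by apply: le_Rintegral => //; exact: integrable_norm.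
Qed.

Lemma Rintegral_probability_cst (k : R) : \int[P]_x k = k.
Proof. by rewrite Rintegral_cst//= probability_setT mulr1. Qed.

Lemma Rintegral_eq0_ae f : rintegrable f -> (forall x, 0 <= f x) ->
  \int[P]_x f x = 0 -> {ae P, forall x, f x = 0}.
Proof.
move=> fi f0 If.
have mf : measurable_fun setT (EFin \o f) := measurable_int _ fi.
have : (\int[P]_x `|(EFin \o f) x| = 0)%E.
  have -> : (\int[P]_x `|(EFin \o f) x| = \int[P]_x (f x)%:E)%E.
    by apply: eq_integral => x _ /=; rewrite ger0_norm.
  by rewrite -(fineK (integrable_fin_num measurableT fi))
    -[fine _]/(\int[P]_x f x) If.
move=> /(ae_eq_integral_abs P measurableT mf).1; apply: filterS => x /(_ I).
by case.
Qed.

Lemma ae_eq_Rintegral f g : measurable_fun setT f -> measurable_fun setT g ->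
  {ae P, forall x, f x = g x} -> \int[P]_x f x = \int[P]_x g x.
Proof.
move=> mf mg fg; congr fine; apply: ae_eq_integral => //;
  try exact/measurable_EFinP.
by apply: filterS fg => x fgx _; rewrite fgx.
Qed.

End RealIntegral.

(** * Differentiability and strict convexity of the cumulant generating function *)

Section CumulantGeneratingFunction.
Context (d : measure_display) (T : measurableType d) (R : realType)
  (P : probability T R) (Z : T -> R) (J : set R).
Hypothesis mZ : measurable_fun setT Z.
Hypothesis exp_integrable : forall u, J u ->
  rintegrable P (fun x => expR (u * Z x)).
Hypothesis Jopen : forall u, J u ->
  exists2 e : R, 0 < e & forall v, `|v - u| <= e -> J v.

Let L (u : R) : R := \int[P]_x expR (u * Z x).
Let L1 (u : R) : R := \int[P]_x (Z x * expR (u * Z x)).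

Let mexp u : measurable_fun setT (fun x => expR (u * Z x)).
Proof.
by apply: measurableT_comp => //; exact: measurable_funM.
Qed.

Let mpoly_exp k u : measurable_fun setT (fun x => Z x ^+ k * expR (u * Z x)).
Proof. by apply: measurable_funM => //; exact: measurable_funX. Qed.

(** Openness of [J] leaves room around [u] to absorb the polynomial factor. *)
Lemma abs_moment_exp_integrable k u : J u ->
  rintegrable P (fun x => `|Z x| ^+ k * expR (u * Z x)).
Proof.
move=> /Jopen[e e0 Je].
have Jp : J (u + e) by apply: Je; rewrite [u + e]addrC addrK gtr0_norm.
have Jm : J (u - e) by apply: Je; rewrite [u - e]addrC addrK normrN gtr0_norm.
apply: rintegrable_le; last first.
- by move=> x; rewrite ger0_norm ?mulr_ge0 ?exprn_ge0 ?expR_ge0//;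
    exact: (norm_exp_mul_expR_le k u (Z x) e0).
- by apply: rintegrableZ; apply: rintegrableD; exact: exp_integrable.
apply: measurable_funM => //; apply: measurable_funX; exact: measurableT_comp.
Qed.

Lemma moment_exp_integrable k u : J u ->
  rintegrable P (fun x => Z x ^+ k * expR (u * Z x)).
Proof.
move=> Ju; apply: rintegrable_le (abs_moment_exp_integrable k Ju) _ => // x.
by rewrite normrM normrX (ger0_norm (expR_ge0 _)).
Qed.

Lemma mul_exp_integrable u : J u -> rintegrable P (fun x => Z x * expR (u * Z x)).
Proof. exact: (@moment_exp_integrable 1). Qed.

(** The right-hand side does not depend on [h], so it dominates uniformly for [|h| <= e]. *)
Lemma expR_norm_mul_le (e u h z : R) : `|h| <= e ->
  expR `|h * z| * expR (u * z) <= expR ((u + e) * z) + expR ((u - e) * z).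
Proof.
move=> he; apply: (@le_trans _ _ (expR (`|e * z|) * expR (u * z))).
  rewrite ler_wpM2r ?expR_ge0// ler_expR !normrM ler_wpM2r//.
  by rewrite (le_trans he)// ler_norm.
apply: (@le_trans _ _ ((expR (e * z) + expR (- (e * z))) * expR (u * z))).
  by rewrite ler_wpM2r ?expR_ge0// expR_norm_le.
rewrite mulrDl -!expRD (_ : e * z + u * z = (u + e) * z); last by ring.
by rewrite (_ : - (e * z) + u * z = (u - e) * z)//; ring.
Qed.

(** The integrand's first-order remainder is at most [h^2] times an integrable function independent
    of [h], by [expR_taylor2] and [expR_norm_mul_le]; integration gives the quadratic bound. *)
Lemma is_derive_mgf u : J u -> is_derive u 1 L (L1 u).
Proof.
move=> Ju; have [e e0 Je] := Jopen Ju.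
have Jp : J (u + e) by apply: Je; rewrite [u + e]addrC addrK gtr0_norm.
have Jm : J (u - e) by apply: Je; rewrite [u - e]addrC addrK normrN gtr0_norm.
pose C := \int[P]_x (Z x ^+ 2 * expR ((u + e) * Z x) +
                     Z x ^+ 2 * expR ((u - e) * Z x)).
apply: (@is_derive_quadratic _ _ _ _ C e) => // h he.
have Jh : J (u + h) by apply: Je; rewrite [u + h]addrC addrK ltW.
have -> : L (u + h) - L u - h * L1 u =
    \int[P]_x (expR ((u + h) * Z x) - expR (u * Z x) - h * (Z x * expR (u * Z x))).
  rewrite RintegralB//; last 2 first.
  - by apply: rintegrableB; exact: exp_integrable.
  - by apply: rintegrableZ; exact: mul_exp_integrable.
  rewrite RintegralB//; try exact: exp_integrable.
  by rewrite RintegralZl//; exact: mul_exp_integrable.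
have iC : rintegrable P (fun x => Z x ^+ 2 * expR ((u + e) * Z x) +
                     Z x ^+ 2 * expR ((u - e) * Z x)).
  by apply: rintegrableD; exact: moment_exp_integrable.
rewrite /C -RintegralZr//; apply: norm_Rintegral_le.
- apply: rintegrableB; first by apply: rintegrableB; exact: exp_integrable.
  by apply: rintegrableZ; exact: mul_exp_integrable.
- have := rintegrableZ (h ^+ 2) iC; congr (rintegrable _ _).
  by apply/funext => x; rewrite mulrC.
move=> x.
have -> : expR ((u + h) * Z x) - expR (u * Z x) - h * (Z x * expR (u * Z x)) =
    (expR (h * Z x) - 1 - h * Z x) * expR (u * Z x).
  by rewrite mulrDl expRD; ring.
rewrite normrM (ger0_norm (expR_ge0 _)).
apply: (@le_trans _ _ (`|h * Z x| ^+ 2 * expR `|h * Z x| * expR (u * Z x))).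
  by rewrite ler_wpM2r ?expR_ge0// expR_taylor2.
rewrite -mulrDr mulrAC -mulrA mulrAC -mulrA.
rewrite [X in _ <= X](_ : _ = `|h * Z x| ^+ 2 *
    (expR ((u + e) * Z x) + expR ((u - e) * Z x))); last first.
  by rewrite real_normK ?num_real// exprMn; ring.
rewrite [X in X <= _](_ : _ = `|h * Z x| ^+ 2 *
    (expR `|h * Z x| * expR (u * Z x))); last by ring.
by rewrite ler_wpM2l ?exprn_ge0//; apply: expR_norm_mul_le; exact: ltW.
Qed.

Hypothesis J0 : J 0.
Hypothesis Z_mean0 : \int[P]_x Z x = 0.

Let exp0E k : (fun x => Z x ^+ k * expR (0 * Z x)) = (fun x => Z x ^+ k).
Proof. by apply/funext => x; rewrite mul0r expR0 mulr1. Qed.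

Lemma moment_integrable k : rintegrable P (fun x => Z x ^+ k).
Proof. by rewrite -exp0E; exact: moment_exp_integrable. Qed.

Let Z_integrable : rintegrable P Z.
Proof. exact: (@moment_integrable 1). Qed.

(** Jensen's inequality in the form [1 + y <= exp y], with [Z] of mean 0. It keeps [ln] and division
    by [L] away from their default values. *)
Lemma mgf_ge1 u : J u -> 1 <= L u.
Proof.
move=> Ju; have uZ := rintegrableZ u Z_integrable.
have := rintegrableD (rintegrable_cst P 1) uZ => i1.
have := le_Rintegral measurableT i1 (exp_integrable Ju).
rewrite (RintegralD measurableT (rintegrable_cst P 1) uZ).
rewrite Rintegral_probability_cst (RintegralZl u measurableT Z_integrable) Z_mean0.
by rewrite mulr0 addr0; apply => x _; exact: expR_ge1Dx.
Qed.

Lemma mgf0 : L 0 = 1.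
Proof.
rewrite -[RHS](Rintegral_probability_cst P); apply: eq_Rintegral => x _.
by rewrite mul0r expR0.
Qed.

Lemma is_derive_cgf u : J u -> is_derive u 1 (fun v => ln (L v)) (L1 u / L u).
Proof.
move=> Ju; rewrite mulrC.
apply: (@is_derive1_comp _ (@ln R) L); last exact: is_derive_mgf.
by apply: is_derive1_ln; rewrite (lt_le_trans ltr01)// mgf_ge1.
Qed.

Hypothesis Z_var : 0 < \int[P]_x (Z x ^+ 2).

Lemma cgf_derivative_increasing s t : J s -> J t -> s < t ->
  L1 s / L s < L1 t / L t.
Proof.
move=> Js Jt st; set c := L1 s / L s.
have Ls : 0 < L s by rewrite (lt_le_trans ltr01)// mgf_ge1.
have Lt : 0 < L t by rewrite (lt_le_trans ltr01)// mgf_ge1.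
rewrite ltr_pdivlMr//.
pose g u x := Z x * expR (u * Z x) - c * expR (u * Z x).
have ig u : J u -> rintegrable P (g u).
  move=> Ju; apply: rintegrableB; first exact: mul_exp_integrable.
  by apply: rintegrableZ; exact: exp_integrable.
have Ig u : J u -> \int[P]_x g u x = L1 u - c * L u.
  move=> Ju; rewrite /g RintegralB//; last 2 first.
  - exact: mul_exp_integrable.
  - by apply: rintegrableZ; exact: exp_integrable.
  by rewrite RintegralZl//; exact: exp_integrable.
have Igs : \int[P]_x g s x = 0 by rewrite Ig// /c divfK ?gt_eqF// subrr.
(* With this factor [q] equals [exp (s c) (Z - c) (exp (t (Z - c)) - exp (s (Z - c)))], whose two
   factors containing [Z - c] have the same sign; and [g s] has mean 0 by the choice of [c]. *)
pose k := expR ((s - t) * c).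
pose q x := k * g t x - g s x.
have iq : rintegrable P q.
  by apply: rintegrableB; [apply: rintegrableZ|]; exact: ig.
have Iq : \int[P]_x q x = k * (L1 t - c * L t).
  rewrite /q RintegralB//; [|by apply: rintegrableZ; exact: ig|exact: ig].
  by rewrite Igs subr0 RintegralZl ?Ig//; exact: ig.
have qE x : q x = (Z x - c) * (expR ((t - s) * (Z x - c)) - 1) * expR (s * Z x).
  have -> : (t - s) * (Z x - c) = (s - t) * c + t * Z x - s * Z x by ring.
  rewrite /q /g /k !expRD expRN; field; exact: lt0r_neq0 (expR_gt0 _).
have q0 x : 0 <= q x.
  rewrite qE mulr_ge0 ?expR_ge0//.
  have [zc|zc] := leP 0 (Z x - c).
    by rewrite mulr_ge0// subr_ge0 -expR0 ler_expR mulr_ge0// subr_ge0 ltW.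
  rewrite mulr_le0 ?(ltW zc)// subr_le0 -expR0 ler_expR pmulr_rle0 ?subr_gt0//.
  exact: ltW.
(* If [q] had mean 0 it would vanish a.s., forcing [Z = c] a.s.; then [c] is the mean 0 and the
   variance would be 0. *)
rewrite -subr_gt0 -(pmulr_rgt0 _ (expR_gt0 ((s - t) * c))) -/k -Iq lt_neqAle.
rewrite Rintegral_ge0// andbT eq_sym; apply/eqP => /(Rintegral_eq0_ae iq q0) Zc.
have {}Zc : {ae P, forall x, Z x = c}.
  apply: filterS Zc => x /eqP; rewrite qE !mulf_eq0 subr_eq0.
  rewrite (gt_eqF (expR_gt0 _)) orbF => /orP[/eqP//|].
  rewrite subr_eq0 -expR0 => /eqP/expR_inj/eqP; rewrite mulf_eq0.
  by rewrite subr_eq0 (gt_eqF st)/= subr_eq0 => /eqP.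
have c0 : c = 0.
  rewrite -Z_mean0 -[LHS](Rintegral_probability_cst P).
  by apply: ae_eq_Rintegral => //; apply: filterS Zc => x ->.
move: Z_var; rewrite (_ : \int[P]_x _ = \int[P]_x 0).
  by rewrite Rintegral_probability_cst ltxx.
apply: ae_eq_Rintegral => //; first exact: measurable_funX.
by apply: filterS Zc => x ->; rewrite c0 expr0n.
Qed.

End CumulantGeneratingFunction.

(** * Orders of vanishing at 0 *)

Section PowerOrder.
Context (R : realType).
Implicit Types (f g z : R -> R) (j k : nat).

(** The neighbourhood is not punctured: the bound then survives substituting a function that may
    take the value 0, and for positive [k] it gives [f 0 = 0]. The sign of [C] is left free, whence
    the [|C|] in several proofs. *)
Definition vanishes_to_order k f :=
  exists C, \forall x \near (0 : R), `|f x| <= C * `|x| ^+ k.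

Lemma vanishes_eq k f g : (\forall x \near (0 : R), f x = g x) ->
  vanishes_to_order k f -> vanishes_to_order k g.
Proof. by move=> fg [C fC]; exists C; near=> x; rewrite -(near fg x)//; near: x.
Unshelve. all: by end_near. Qed.

Lemma vanishes_eqfun k f g : f =1 g ->
  vanishes_to_order k f -> vanishes_to_order k g.
Proof. by move=> fg; apply: vanishes_eq; near=> x; exact: fg.
Unshelve. all: by end_near. Qed.

Lemma vanishesD k f g : vanishes_to_order k f -> vanishes_to_order k g ->
  vanishes_to_order k (fun x => f x + g x).
Proof.
move=> [C fC] [D gD]; exists (C + D); near=> x.
rewrite (le_trans (ler_normD _ _))// mulrDl lerD//.
  by near: x.
by near: x.
Unshelve. all: by end_near. Qed.

Lemma vanishesM j k f g : vanishes_to_order j f -> vanishes_to_order k g ->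
  vanishes_to_order (j + k) (fun x => f x * g x).
Proof.
move=> [C fC] [D gD]; exists (C * D); near=> x.
rewrite normrM exprD mulrACA ler_pM//.
  by near: x.
by near: x.
Unshelve. all: by end_near. Qed.

Lemma vanishes_cst (c : R) : vanishes_to_order 0 (fun=> c).
Proof. by exists `|c|; near=> x; rewrite expr0 mulr1.
Unshelve. all: by end_near. Qed.

Lemma vanishesZ k (c : R) f : vanishes_to_order k f ->
  vanishes_to_order k (fun x => c * f x).
Proof. exact: (vanishesM (vanishes_cst c)). Qed.

Lemma vanishesX k : vanishes_to_order k (fun x => x ^+ k).
Proof. by exists 1; near=> x; rewrite mul1r normrX.
Unshelve. all: by end_near. Qed.

Lemma vanishes_id : vanishes_to_order 1 (fun x => x).
Proof. exact: (vanishesX 1). Qed.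

Lemma vanishesW j k f : (k <= j)%N -> vanishes_to_order j f ->
  vanishes_to_order k f.
Proof.
move=> kj [C fC]; exists `|C|; near=> x.
have x1 : `|x| <= 1.
  by near: x; exact: (@nbhs0_le R R).
have : `|f x| <= C * `|x| ^+ j by near: x.
move=> /le_trans; apply; apply: (@le_trans _ _ (`|C| * `|x| ^+ j)).
  by rewrite ler_wpM2r ?exprn_ge0// ler_norm.
by rewrite ler_wpM2l// ler_wiXn2l.
Unshelve. all: by end_near. Qed.

Lemma vanishes_comp k f z : z x @[x --> (0 : R)] --> (0 : R) ->
  vanishes_to_order k f -> vanishes_to_order 1 z ->
  vanishes_to_order k (f \o z).
Proof.
move=> z0 [C fC] [D zD]; exists (`|C| * D ^+ k); near=> x.
have fz : `|f (z x)| <= C * `|z x| ^+ k.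
  by near: x; exact: (z0 _ fC).
have zx : `|z x| <= D * `|x| ^+ 1 by near: x.
rewrite expr1 in zx.
apply: (le_trans fz); apply: (@le_trans _ _ (`|C| * `|z x| ^+ k)).
  by rewrite ler_wpM2r ?exprn_ge0// ler_norm.
by rewrite -mulrA -exprMn ler_wpM2l// lerXn2r// nnegrE// (le_trans _ zx).
Unshelve. all: by end_near. Qed.

(* At [x = 0] the quotient is [0] by convention, so the bound holds there too. *)
Lemma vanishes_div k f : vanishes_to_order k.+1 f ->
  vanishes_to_order k (fun x => f x / x).
Proof.
move=> [C fC]; exists `|C|; near=> x.
have [->|x0] := eqVneq x 0.
  by rewrite invr0 mulr0 normr0 mulr_ge0// exprn_ge0.
rewrite normrM normfV ler_pdivrMr ?normr_gt0// -mulrA -exprSr.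
have : `|f x| <= C * `|x| ^+ k.+1 by near: x.
by move=> /le_trans; apply; rewrite ler_wpM2r ?exprn_ge0// ler_norm.
Unshelve. all: by end_near. Qed.

Lemma vanishes_cvg k f : vanishes_to_order k.+1 f ->
  f x @[x --> (0 : R)] --> (0 : R).
Proof.
move=> /(vanishesW (isT : (1 <= k.+1)%N)) [C fC].
apply/cvgrPdist_le => e e0; near=> x.
rewrite sub0r normrN.
have : `|f x| <= C * `|x| ^+ 1 by near: x.
have xe : `|x| < e / (`|C| + 1).
  by near: x; apply: (@nbhs0_lt R R); rewrite divr_gt0// ltr_wpDl.
move: xe; rewrite ltr_pdivlMr ?ltr_wpDl// => xe; rewrite expr1.
move=> /le_trans; apply.
have := ler_norm C; have := normr_ge0 x; have := normr_ge0 C; nra.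
Unshelve. all: by end_near. Qed.

(** [|exp y - 1| <= |y| exp |y|], and [|f| <= 1] near 0, which gives the constant [C * expR 1]. *)
Lemma vanishes_expRB1 k f : vanishes_to_order k.+1 f ->
  vanishes_to_order k.+1 (fun x => expR (f x) - 1).
Proof.
move=> vf; have f0 := vanishes_cvg vf; case: vf => C fC.
exists (C * expR 1); near=> x.
apply: (le_trans (expR_taylor1 _)); rewrite expr1 mulrAC ler_pM ?expR_ge0//.
  by near: x.
rewrite ler_expR; near: x.
by move/cvgrPdist_le : f0 => /(_ _ ltr01); apply: filterS => x;
  rewrite sub0r normrN.
Unshelve. all: by end_near. Qed.

Lemma vanishes_bigO k f : let F0 : set_system R := (0 : R)^' in
  vanishes_to_order k f -> f =O_F0 (fun x => x ^+ k).
Proof.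
move=> F0 [C fC]; apply/eqOP; near=> D; near=> x.
have : `|f x| <= C * `|x| ^+ k.
  by near: x; exact: (nbhs_dnbhs fC).
move=> /le_trans; apply; rewrite normrX ler_wpM2r ?exprn_ge0//.
Unshelve. all: by end_near. Qed.

End PowerOrder.

(** * Expansion of the root of [dphi (zeta e) = e], with [v] standing for the variance *)

Section InverseExpansion.
Context (R : realType) (phi dphi zeta : R -> R) (v nu : R).
Hypothesis v0 : 0 < v.
Hypothesis phiE :
  vanishes_to_order 4 (fun s => phi s - (v / 2 * s ^+ 2 + nu / 6 * s ^+ 3)).
Hypothesis dphiE :
  vanishes_to_order 3 (fun s => dphi s - (v * s + nu / 2 * s ^+ 2)).
Hypothesis zeta_cvg0 : zeta x @[x --> (0 : R)] --> (0 : R).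
Hypothesis zeta_root : \forall e \near (0 : R), dphi (zeta e) = e.

Let vN0 : v != 0. Proof. by rewrite gt_eqF. Qed.

(** The equation reads [v * zeta e = e - r (zeta e)] with [r] quadratic. Once [zeta e] is small,
    [|r (zeta e)|] is at most half of [v |zeta e|] and is absorbed on the left, leaving the constant
    [2 / v]. *)
Lemma zeta_vanishes1 : vanishes_to_order 1 zeta.
Proof.
have r2 : vanishes_to_order 2 (fun s => dphi s - v * s).
  have := vanishesD (vanishesW (isT : (2 <= 3)%N) dphiE)
    (vanishesZ (nu / 2) (vanishesX R 2)).
  by apply: vanishes_eqfun => s; ring.
case: r2 => C r2; exists (2 / v); near=> e.
have ze : dphi (zeta e) = e by near: e; exact: zeta_root.
have : `|dphi (zeta e) - v * zeta e| <= C * `|zeta e| ^+ 2.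
  by near: e; exact: (zeta_cvg0 r2).
rewrite ze expr1 => re.
have small : `|zeta e| < v / 2 / (`|C| + 1).
  near: e; have /cvgrPdist_lt := zeta_cvg0.
  have p : 0 < v / 2 / (`|C| + 1) by rewrite !divr_gt0// ltr_wpDl.
  by move=> /(_ _ p); apply: filterS => x; rewrite sub0r normrN.
have tri : `|v * zeta e| <= `|e| + `|e - v * zeta e|.
  by have := ler_normB e (e - v * zeta e); rewrite subKr.
have C1 : 0 < `|C| + 1 by rewrite ltr_wpDl.
move: small; rewrite ltr_pdivlMr// => small.
rewrite mulrAC ler_pdivlMr// mulrC.
move: tri; rewrite normrM (gtr0_norm v0) => tri.
have := normr_ge0 (zeta e); have := ler_norm C.
set z := `|zeta e| in re small tri *; set ae := `|e| in tri *.
set c := `|C| in small *; move=> Cc z0.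
have : C * z ^+ 2 <= v / 2 * z.
  apply: (@le_trans _ _ (c * z * z)); last by apply: ler_wpM2r => //; nra.
  by rewrite expr2 mulrA !ler_wpM2r.
lra.
Unshelve. all: by end_near. Qed.

(** First iteration: [zeta e - e / v] is [- v^-1] times the nonlinear part of [dphi] at [zeta e]. *)
Lemma zeta_remainder1 : vanishes_to_order 2 (fun e => zeta e - e / v).
Proof.
have c := vanishes_comp zeta_cvg0 dphiE zeta_vanishes1.
have := vanishesZ (- v^-1) (vanishesD (vanishesW (isT : (2 <= 3)%N) c)
  (vanishesZ (nu / 2) (vanishesM zeta_vanishes1 zeta_vanishes1))).
apply: vanishes_eq; near=> e.
have ze : dphi (zeta e) = e by near: e; exact: zeta_root.
by rewrite /= ze; field.
Unshelve. all: by end_near. Qed.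

(** Factoring the difference of squares gives order 2 + 1; the difference of cubes below likewise
    gives 2 + 2. *)
Lemma zeta_sqr_remainder :
  vanishes_to_order 3 (fun e => zeta e ^+ 2 - (e / v) ^+ 2).
Proof.
have := vanishesM zeta_remainder1
  (vanishesD zeta_vanishes1 (vanishesZ v^-1 (vanishes_id R))).
by apply: vanishes_eqfun => e; ring.
Qed.

Lemma zeta_cube_remainder :
  vanishes_to_order 4 (fun e => zeta e ^+ 3 - (e / v) ^+ 3).
Proof.
have ev := vanishesZ v^-1 (vanishes_id R); have z := zeta_vanishes1.
have := vanishesM zeta_remainder1
  (vanishesD (vanishesD (vanishesM z z) (vanishesM z ev)) (vanishesM ev ev)).
by apply: vanishes_eqfun => e; ring.
Qed.

(** Second iteration: in the quadratic term of [dphi], [zeta e ^+ 2] may now be replaced by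
    [(e / v) ^+ 2] with an error of order 3. *)
Lemma zeta_remainder2 :
  vanishes_to_order 3 (fun e => zeta e - e / v + nu * e ^+ 2 / (2 * v ^+ 3)).
Proof.
have c := vanishes_comp zeta_cvg0 dphiE zeta_vanishes1.
have := vanishesZ (- v^-1) (vanishesD c
  (vanishesZ (nu / 2) zeta_sqr_remainder)).
apply: vanishes_eq; near=> e.
have ze : dphi (zeta e) = e by near: e; exact: zeta_root.
by rewrite /= ze; field.
Unshelve. all: by end_near. Qed.

(** Completing the square, [v / 2 * z ^+ 2 - e * z] is [- e ^+ 2 / (2 * v)] plus
    [v / 2 * (z - e / v) ^+ 2]. Only the square of the first remainder enters, so order 2 for [zeta]
    already yields order 4 here. *)
Lemma legendre_expansion : vanishes_to_order 4 (fun e =>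
  phi (zeta e) - e * zeta e -
  (- (e ^+ 2) / (2 * v) + nu * e ^+ 3 / (6 * v ^+ 3))).
Proof.
have c := vanishes_comp zeta_cvg0 phiE zeta_vanishes1.
have := vanishesD (vanishesD c
  (vanishesZ (v / 2) (vanishesM zeta_remainder1 zeta_remainder1)))
  (vanishesZ (nu / 6) zeta_cube_remainder).
by apply: vanishes_eqfun => e /=; field.
Qed.

Lemma zeta_neq0 : \forall e \near (0 : R)^', zeta e != 0.
Proof.
(* The bound [dphiE] is evaluated at the point 0 itself. *)
have dphi0 : dphi 0 = 0.
  case: dphiE => C /nbhs_singleton.
  by rewrite normr0 !expr0n /= !mulr0 addr0 subr0 normr_le0 => /eqP.
near=> e; apply/negP => /eqP ze0.
have : dphi (zeta e) = e by near: e; exact: (nbhs_dnbhs zeta_root).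
rewrite ze0 dphi0; apply/eqP; rewrite eq_sym.
by near: e; exact: nbhs_dnbhs_neq.
Unshelve. all: by end_near. Qed.

(** [phi z / z] is [v / 2 * z + nu / 6 * z ^+ 2] up to order 3. Inserting [zeta], the quadratic
    coefficients [- nu / (4 v^2)] and [nu / (6 v^2)] add up to [- nu / (12 v^2)]. *)
Lemma ratio_expansion : exists2 r, vanishes_to_order 2 r &
  \forall e \near (0 : R)^',
    phi (zeta e) / zeta e = e / 2 * (1 - nu * e / (6 * v ^+ 2) + r e).
Proof.
pose q s := (phi s - (v / 2 * s ^+ 2 + nu / 6 * s ^+ 3)) / s.
have qz := vanishes_comp zeta_cvg0 (vanishes_div phiE) zeta_vanishes1.
have := vanishesD (vanishesD qz (vanishesZ (v / 2) zeta_remainder2))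
  (vanishesZ (nu / 6) zeta_sqr_remainder).
set B := (X in vanishes_to_order 3 X) => BO.
(* The prefactor [e / 2] is divided out of the error, which costs one order. *)
exists (fun e => 2 * (B e / e)); first exact/vanishesZ/vanishes_div.
near=> e.
have e0 : e != 0 by near: e; exact: nbhs_dnbhs_neq.
have z0 : zeta e != 0 by near: e; exact: zeta_neq0.
by rewrite /B /=; field; rewrite vN0 e0 z0.
Unshelve. all: by end_near. Qed.

End InverseExpansion.

(** The lower bound comes from applying [ln y <= y - 1] to [y = 1 / (1 + w)]. *)
Lemma norm_ln1D_sub_le (R : realType) (w : R) : 0 <= w ->
  `|ln (1 + w) - w| <= w ^+ 2.
Proof.
move=> w0; have w1 : 0 < 1 + w by rewrite ltr_wpDr.
have up : ln (1 + w) <= w by apply: le_ln1Dx; lra.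
have : ln (1 + ((1 + w)^-1 - 1)) <= (1 + w)^-1 - 1.
  by apply: le_ln1Dx; rewrite ltrBrDr addNr invr_gt0.
rewrite addrC subrK lnV ?posrE// => lo.
have : (1 + w)^-1 - 1 <= w ^+ 2 - w.
  have -> : (1 + w)^-1 - 1 = - w / (1 + w) by field; exact: lt0r_neq0.
  rewrite ler_pdivrMr//; nra.
by rewrite ler_norml; lra.
Qed.

(** * Taylor expansions of the cumulant generating function and its derivative *)

Section CgfExpansion.
Context (d : measure_display) (T : measurableType d) (R : realType)
  (P : probability T R) (Z : T -> R) (J : set R).
Hypothesis mZ : measurable_fun setT Z.
Hypothesis exp_integrable : forall u, J u ->
  rintegrable P (fun x => expR (u * Z x)).
Hypothesis Jopen : forall u, J u ->
  exists2 e : R, 0 < e & forall v, `|v - u| <= e -> J v.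
Hypothesis J0 : J 0.
Hypothesis Z_mean0 : \int[P]_x Z x = 0.

Let L (u : R) : R := \int[P]_x expR (u * Z x).
Let L1 (u : R) : R := \int[P]_x (Z x * expR (u * Z x)).
Let v : R := \int[P]_x (Z x ^+ 2).
Let nu : R := \int[P]_x (Z x ^+ 3).

(** For [|s| <= e] the factor multiplying [|s| ^+ k] is dominated by an integrable function
    independent of [s]. *)
Lemma vanishes_Rintegral k j (f : R -> R -> R) :
  (forall s, measurable_fun setT (f s)) ->
  (forall s z, `|f s z| <= `|s| ^+ k * (`|z| ^+ j * expR `|s * z|)) ->
  vanishes_to_order k (fun s => \int[P]_x f s (Z x)).
Proof.
move=> mf fle; have [e e0 Je] := Jopen J0.
have Jp : J (0 + e) by apply: Je; rewrite [0 + e]addrC addrK gtr0_norm.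
have Jm : J (0 - e) by apply: Je; rewrite [0 - e]addrC addrK normrN gtr0_norm.
pose g x := `|Z x| ^+ j * expR ((0 + e) * Z x) + `|Z x| ^+ j * expR ((0 - e) * Z x).
have ig : rintegrable P g.
  by apply: rintegrableD;
    exact: (abs_moment_exp_integrable mZ exp_integrable Jopen).
exists (\int[P]_x g x); near=> s.
have se : `|s| <= e by near: s; exact: (@nbhs0_le R R).
have fg x : `|f s (Z x)| <= `|s| ^+ k * g x.
  apply: (le_trans (fle _ _)); rewrite ler_wpM2l ?exprn_ge0// /g -mulrDr.
  rewrite ler_wpM2l ?exprn_ge0//.
  have := expR_norm_mul_le 0 (Z x) se.
  by rewrite mul0r expR0 mulr1.
have igk := rintegrableZ (`|s| ^+ k) ig.
rewrite mulrC -RintegralZl//; apply: norm_Rintegral_le => //.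
by apply: rintegrable_le igk fg; exact: measurableT_comp.
Unshelve. all: by end_near. Qed.

Let Z_pow_integrable k : rintegrable P (fun x => Z x ^+ k) :=
  moment_integrable mZ exp_integrable Jopen J0 k.

Let Z_integrable : rintegrable P Z := Z_pow_integrable 1.

Let J_near : \forall s \near (0 : R), J s.
Proof.
have [e e0 Je] := Jopen J0; near=> s; apply: Je.
by rewrite subr0; near: s; exact: (@nbhs0_le R R).
Unshelve. all: by end_near. Qed.

Lemma mgf_expansion :
  vanishes_to_order 4 (fun s => L s - 1 - (v / 2 * s ^+ 2 + nu / 6 * s ^+ 3)).
Proof.
pose f (s z : R) :=
  expR (s * z) - 1 - s * z - (s * z) ^+ 2 / 2 - (s * z) ^+ 3 / 6.
have mf s : measurable_fun setT (f s).
  have ms : measurable_fun setT (fun z : R => s * z) by exact: measurable_funM.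
  by apply: measurable_funB; [apply: measurable_funB; [apply: measurable_funB =>
    //; apply: measurable_funB => //; exact: measurableT_comp|]|];
    apply: measurable_funM => //; exact: measurable_funX.
have fle s z : `|f s z| <= `|s| ^+ 4 * (`|z| ^+ 4 * expR `|s * z|).
  by rewrite mulrA -exprMn -normrM; exact: expR_taylor4.
have := vanishes_Rintegral mf fle; apply: vanishes_eq; near=> s.
have Js : J s by near: s.
have i0 := exp_integrable Js.
have i1 := rintegrable_cst P 1.
have i2 := rintegrableZ s Z_integrable.
have i3 := rintegrableZ (s ^+ 2 / 2) (Z_pow_integrable 2).
have i4 := rintegrableZ (s ^+ 3 / 6) (Z_pow_integrable 3).
transitivity (\int[P]_x (expR (s * Z x) - 1 - s * Z x - s ^+ 2 / 2 * Z x ^+ 2 -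
    s ^+ 3 / 6 * Z x ^+ 3)).
  by apply: eq_Rintegral => x _; rewrite /f; field.
have i01 := rintegrableB i0 i1.
have i012 := rintegrableB i01 i2.
have i0123 := rintegrableB i012 i3.
rewrite (RintegralB measurableT i0123 i4) (RintegralB measurableT i012 i3).
rewrite (RintegralB measurableT i01 i2) (RintegralB measurableT i0 i1).
rewrite (RintegralZl _ measurableT Z_integrable).
rewrite (RintegralZl _ measurableT (Z_pow_integrable 2)).
rewrite (RintegralZl _ measurableT (Z_pow_integrable 3)).
rewrite Rintegral_probability_cst Z_mean0 -/(L s) -/v -/nu; ring.
Unshelve. all: by end_near. Qed.

Lemma mgf_derivative_expansion :
  vanishes_to_order 3 (fun s => L1 s - (v * s + nu / 2 * s ^+ 2)).
Proof.
pose f (s z : R) := z * (expR (s * z) - 1 - s * z - (s * z) ^+ 2 / 2).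
have mf s : measurable_fun setT (f s).
  have ms : measurable_fun setT (fun z : R => s * z) by exact: measurable_funM.
  apply: measurable_funM => //; apply: measurable_funB.
    by apply: measurable_funB => //; apply: measurable_funB => //;
      exact: measurableT_comp.
  by apply: measurable_funM => //; exact: measurable_funX.
have fle s z : `|f s z| <= `|s| ^+ 3 * (`|z| ^+ 4 * expR `|s * z|).
  rewrite normrM [X in _ <= X](_ : _ = `|z| * (`|s * z| ^+ 3 * expR `|s * z|)).
    by rewrite ler_wpM2l// expR_taylor3.
  by rewrite normrM; ring.
have := vanishes_Rintegral mf fle; apply: vanishes_eq; near=> s.
have Js : J s by near: s.
have i0 := mul_exp_integrable mZ exp_integrable Jopen Js.
have i2 := rintegrableZ s (Z_pow_integrable 2).
have i3 := rintegrableZ (s ^+ 2 / 2) (Z_pow_integrable 3).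
transitivity (\int[P]_x (Z x * expR (s * Z x) - Z x - s * Z x ^+ 2 -
    s ^+ 2 / 2 * Z x ^+ 3)).
  by apply: eq_Rintegral => x _; rewrite /f; field.
have i01 := rintegrableB i0 Z_integrable.
have i012 := rintegrableB i01 i2.
rewrite (RintegralB measurableT i012 i3).
rewrite (RintegralB measurableT i01 i2) (RintegralB measurableT i0 Z_integrable).
rewrite (RintegralZl _ measurableT (Z_pow_integrable 2)).
rewrite (RintegralZl _ measurableT (Z_pow_integrable 3)).
rewrite Z_mean0 -/(L1 s) -/v -/nu; ring.
Unshelve. all: by end_near. Qed.

Let L_ge1 := mgf_ge1 mZ exp_integrable Jopen J0 Z_mean0.

Lemma mgf_sub1_vanishes2 : vanishes_to_order 2 (fun s => L s - 1).
Proof.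
have X2 := vanishesZ (v / 2) (vanishesX R 2).
have X3 := vanishesZ (nu / 6) (vanishesW (isT : (2 <= 3)%N) (vanishesX R 3)).
have := vanishesD (vanishesW (isT : (2 <= 4)%N) mgf_expansion) (vanishesD X2 X3).
by apply: vanishes_eqfun => s; ring.
Qed.

(** Since [L s - 1] has order 2, replacing [ln (L s)] by [L s - 1] costs only order 4. *)
Lemma cgf_expansion :
  vanishes_to_order 4 (fun s => ln (L s) - (v / 2 * s ^+ 2 + nu / 6 * s ^+ 3)).
Proof.
have W : vanishes_to_order 4 (fun s => ln (L s) - (L s - 1)).
  have [C WC] := vanishesM mgf_sub1_vanishes2 mgf_sub1_vanishes2.
  exists C; near=> s.
  have Js : J s by near: s.
  have : 0 <= L s - 1 by rewrite subr_ge0 L_ge1.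
  move=> /norm_ln1D_sub_le; rewrite [1 + _]addrC subrK => /le_trans; apply.
  by rewrite expr2 (le_trans (ler_norm _))//; near: s.
have := vanishesD W mgf_expansion.
by apply: vanishes_eqfun => s; ring.
Unshelve. all: by end_near. Qed.

(** The denominator is harmless: [L1 / L - L1 = - L1 (L - 1) / L] has order 1 + 2. *)
Lemma cgf_derivative_expansion :
  vanishes_to_order 3 (fun s => L1 s / L s - (v * s + nu / 2 * s ^+ 2)).
Proof.
have L1O : vanishes_to_order 1 L1.
  have X1 := vanishesZ v (vanishes_id R).
  have X2 := vanishesZ (nu / 2) (vanishesW (isT : (1 <= 2)%N) (vanishesX R 2)).
  have := vanishesD (vanishesW (isT : (1 <= 3)%N) mgf_derivative_expansion)
    (vanishesD X1 X2).
  by apply: vanishes_eqfun => s; ring.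
have W : vanishes_to_order 3 (fun s => L1 s / L s - L1 s).
  have [C WC] := vanishesM L1O mgf_sub1_vanishes2.
  exists C; near=> s.
  have Js : J s by near: s.
  have Ls : 1 <= L s by exact: L_ge1.
  have Ls0 : 0 < L s by rewrite (lt_le_trans ltr01).
  have -> : L1 s / L s - L1 s = - (L1 s * (L s - 1)) / L s.
    by field; exact: lt0r_neq0.
  rewrite normrM normrN normfV (gtr0_norm Ls0).
  apply: (@le_trans _ _ (`|L1 s * (L s - 1)|)); last by near: s.
  by rewrite ler_pdivrMr// ler_peMr.
have := vanishesD W mgf_derivative_expansion.
by apply: vanishes_eqfun => s; ring.
Unshelve. all: by end_near. Qed.

End CgfExpansion.

(** * The cumulant generating function of a random variable *)

(** Turns the limit at a finite or infinite endpoint into one usable point between that endpoint and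
    0. *)
Lemma right_of_exists (R : realType) (a : \bar R) (f : R -> R) (la : \bar R)
    (e : R) : (a < 0)%E ->
  (fun s => (f s)%:E) @ right_of a --> la -> (la < e%:E)%E ->
  exists s, [/\ (a < s%:E)%E, s < 0 & f s < e].
Proof.
move=> a0 fla lae; have fe := fla _ (open_ereal_lt' lae).
case: a a0 {fla} fe => [x||]//= x0 fe.
  have [|s [[xs s0] fs]] := @filter_ex _ x^'+ _
    (fun s => (x < s /\ s < 0) /\ f s < e); last by exists s; rewrite lte_fin.
  near=> s; split; last by near: s; exact: fe.
  split; near: s; first exact: nbhs_right_gt.
  by apply: nbhs_right_lt; rewrite -lte_fin.
have [|s [s0 fs]] := @filter_ex _ (ninfty_nbhs R) _ (fun s => s < 0 /\ f s < e).
  near=> s; split; last by near: s; exact: fe.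
  by near: s; exact: nbhs_ninfty_lt.
by exists s; split=> //; rewrite ltNyr.
Unshelve. all: by end_near. Qed.

Lemma left_of_exists (R : realType) (b : \bar R) (f : R -> R) (lb : \bar R)
    (e : R) : (0 < b)%E ->
  (fun s => (f s)%:E) @ left_of b --> lb -> (e%:E < lb)%E ->
  exists s, [/\ (s%:E < b)%E, 0 < s & e < f s].
Proof.
move=> b0 flb elb; have fe := flb _ (open_ereal_gt' elb).
case: b b0 {flb} fe => [x||]//= x0 fe.
  have [|s [[sx s0] fs]] := @filter_ex _ x^'- _
    (fun s => (s < x /\ 0 < s) /\ e < f s); last by exists s; rewrite lte_fin.
  near=> s; split; last by near: s; exact: fe.
  split; near: s; first exact: nbhs_left_lt.
  by apply: nbhs_left_gt; rewrite -lte_fin.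
have [|s [s0 fs]] := @filter_ex _ (pinfty_nbhs R) _ (fun s => 0 < s /\ e < f s).
  near=> s; split; last by near: s; exact: fe.
  by near: s; exact: nbhs_pinfty_gt.
by exists s; split=> //; rewrite ltry.
Unshelve. all: by end_near. Qed.

(** The minimum over [[s, t]] is at most [g u], hence not attained at an endpoint, and the
    derivative vanishes there. *)
Lemma interior_critical_point (R : realType) (g dg : R -> R) (s t u : R) :
  s < u < t -> (forall x, s <= x <= t -> is_derive x 1 g (dg x)) ->
  g u < g s -> g u < g t -> exists2 c, s < c < t & dg c = 0.
Proof.
move=> /andP[su ut] dgE gs gt.
have st : s <= t by rewrite ltW// (lt_trans su).
have cg : {within `[s, t], continuous g}.
  apply: derivable_within_continuous => x; rewrite in_itv/= => xst.
  by have [] := dgE x xst.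
have [c cst cmin] := EVT_min st cg.
have gcu : g c <= g u by apply: cmin; rewrite in_itv/= !ltW.
have cI : s < c < t.
  move: cst; rewrite in_itv/= => /andP[sc ct].
  rewrite !lt_neqAle sc ct !andbT; apply/andP; split.
    by apply/eqP => sE; move: gs; rewrite sE ltNge gcu.
  by apply/eqP => tE; move: gt; rewrite -tE ltNge gcu.
exists c => //; have /andP[sc ct] := cI.
have dc : is_derive c 1 g 0.
  apply: (derive1_at_min st) => [x||x]; rewrite ?in_itv//= => /andP[sx xt].
    by have [] : is_derive x 1 g (dg x) by apply: dgE; rewrite !ltW.
  by apply: cmin; rewrite in_itv/= !ltW.
have dgc : is_derive c 1 g (dg c) by apply: dgE; rewrite !ltW.
by rewrite -(@derive_val _ _ _ _ _ _ _ dc) derive_val.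
Qed.

(** * The interval [(a, b)] and integrability on it *)

Section MgfInterval.
Context (d : measure_display) (T : measurableType d) (R : realType)
  (P : probability T R) (Y : {RV P >-> R}).
Hypotheses (lo0 : (mgf_lo Y < 0)%E) (hi0 : (0 < mgf_hi Y)%E).

Definition mgf_domain : set R :=
  [set u | (mgf_lo Y < u%:E)%E /\ (u%:E < mgf_hi Y)%E].

(** As the endpoints are an infimum and a supremum, [u] lies strictly between two reals of finite
    mgf. Infinite endpoints then need no separate treatment. *)
Lemma mgf_domain_bracket u : mgf_domain u -> exists s t,
  [/\ s < u, u < t, (mgf Y s < +oo)%E, (mgf Y t < +oo)%E &
      forall v, s < v < t -> mgf_domain v].
Proof.
move=> [/ereal_inf_lt[_ [s [s0 sfin] <-]] su /ereal_sup_gt[_ [t [t0 tfin] <-]] ut].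
rewrite !lte_fin in su ut; exists s, t; split=> // v /andP[sv vt]; split.
  apply: (@le_lt_trans _ _ s%:E); last by rewrite lte_fin.
  by apply: ereal_inf_lbound; exists s.
apply: (@lt_le_trans _ _ t%:E); first by rewrite lte_fin.
by apply: ereal_sup_ubound; exists t.
Qed.

Lemma mgf_domain0 : mgf_domain 0.
Proof. by split. Qed.

Lemma mgf_domain_open u : mgf_domain u ->
  exists2 e : R, 0 < e & forall v, `|v - u| <= e -> mgf_domain v.
Proof.
move=> /mgf_domain_bracket[s [t [su ut _ _ st]]].
(* Halving makes the closed ball fit in the open bracket. *)
exists (Order.min (u - s) (t - u) / 2).
  by rewrite divr_gt0// lt_min !subr_gt0 su ut.
move=> v; rewrite ler_pdivlMr// le_min => /andP[vs vt].
apply: st; have := ler_norm (v - u); have := ler_norm (u - v).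
rewrite distrC => h1 h2; apply/andP; split; lra.
Qed.

Lemma measurable_expRM (u : R) : measurable_fun setT (fun x => expR (u * Y x)).
Proof. by apply: measurableT_comp => //; exact: measurable_funM. Qed.

Lemma mgf_finite_integrable s : (mgf Y s < +oo)%E ->
  rintegrable P (fun x => expR (s * Y x)).
Proof.
move=> sfin; apply/integrableP; split.
  by apply/measurable_EFinP; exact: measurable_expRM.
under eq_integral do rewrite /= ger0_norm ?expR_ge0//.
exact: sfin.
Qed.

(** [exp (u Y)] is below [exp (t Y)] or [exp (s Y)] according to the sign of [Y]. *)
Lemma mgf_domain_integrable u : mgf_domain u ->
  rintegrable P (fun x => expR (u * Y x)).
Proof.
move=> /mgf_domain_bracket[s [t [su ut sfin tfin _]]].
have ist := rintegrableD (mgf_finite_integrable sfin) (mgf_finite_integrable tfin).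
apply: (rintegrable_le _ ist); first exact: measurable_expRM.
move=> x; rewrite ger0_norm ?expR_ge0//.
have [Y0|Y0] := leP 0 (Y x).
  apply: (@le_trans _ _ (expR (t * Y x))); last by rewrite lerDr expR_ge0.
  by rewrite ler_expR ler_wpM2r// ltW.
apply: (@le_trans _ _ (expR (s * Y x))); last by rewrite lerDl expR_ge0.
by rewrite ler_expR ler_wnM2r// ltW.
Qed.

Lemma mgf_domain_integrable_centered u : mgf_domain u ->
  rintegrable P (fun x => expR (u * (Y x - mean Y))).
Proof.
move=> /mgf_domain_integrable /(rintegrableZ (expR (- (u * mean Y)))).
congr (rintegrable _ _); apply/funext => x.
by rewrite -expRD mulrBr addrC.
Qed.

(** Ensures that [mean Y] is a true expectation, not a default value of [fine]. *)
Lemma rv_integrable : rintegrable P Y.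
Proof.
apply: (moment_integrable _ mgf_domain_integrable mgf_domain_open mgf_domain0 1).
exact: measurable_funP.
Qed.

Lemma Rintegral_centered : \int[P]_x (Y x - mean Y) = 0.
Proof.
rewrite (RintegralB measurableT rv_integrable (rintegrable_cst P _)).
by rewrite Rintegral_probability_cst /mean expectation_def subrr.
Qed.

Lemma var_Rintegral : var Y = \int[P]_x ((Y x - mean Y) ^+ 2).
Proof.
by apply: eq_Rintegral => x _; rewrite real_normK// num_real.
Qed.

Lemma sqr_sd : 0 < sd Y -> sd Y ^+ 2 = \int[P]_x ((Y x - mean Y) ^+ 2).
Proof.
by rewrite /sd sqrtr_gt0 => /ltW v0; rewrite sqr_sqrtr// var_Rintegral.
Qed.

Lemma measurable_centered : measurable_fun setT (fun x => Y x - mean Y).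
Proof. exact: measurable_funB. Qed.

Lemma expR_cgf u : mgf_domain u ->
  expR (cgf Y u) = \int[P]_x expR (u * (Y x - mean Y)).
Proof.
move=> Ju; apply: lnK; rewrite posrE; apply: lt_le_trans ltr01 _.
exact: (mgf_ge1 measurable_centered mgf_domain_integrable_centered
  mgf_domain_open mgf_domain0 Rintegral_centered Ju).
Qed.

End MgfInterval.

(** * The exponential martingale and the maximal inequality of (i) *)

Section CrossingBound.
Context (d : measure_display) (T : measurableType d) (R : realType)
  (P : probability T R) (Y : {RV P >-> R}) (Ys : nat -> {RV P >-> R}).
Hypothesis indep : mutually_independent_rv Ys.
Hypothesis ident : forall i, identically_distributed (Ys i) Y.
Hypotheses (lo0 : (mgf_lo Y < 0)%E) (hi0 : (0 < mgf_hi Y)%E).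

Lemma integral_identically_distributed (f : R -> R) i :
  measurable_fun setT f -> (forall y, 0 <= f y) ->
  (\int[P]_x (f (Ys i x))%:E = \int[P]_x (f (Y x))%:E)%E.
Proof.
move=> mf f0.
have mfE : measurable_fun setT (EFin \o f) by exact/measurable_EFinP.
rewrite -(ge0_integral_distribution (Ys i) mfE)//.
rewrite -(ge0_integral_distribution Y mfE)//.
by apply: eq_measure_integral => A mA _; exact: ident.
Qed.

Variables (m : nat) (eps s : R).
Hypothesis Js : mgf_domain Y s.

Let phi := cgf Y.
Let X := centered_sum Ys (mean Y).

Definition crossing_event : set T :=
  [set x | (0 <= ereal_sup
    [set (s * (X n x - m%:R * eps) - phi s * (n%:R - m%:R))%:E
    | n in [set n : nat | (0 < n)%N]])%E].

Lemma measurable_crossing_event : measurable crossing_event.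
Proof.
pose u n (x : T) := (s * (X n x - m%:R * eps) - phi s * (n%:R - m%:R))%:E.
have mu n : measurable_fun setT (u n).
  apply/measurable_EFinP; apply: measurable_funB => //.
  apply: measurable_funM => //; apply: measurable_funB => //.
  by apply: measurable_sum => i; exact: measurable_funB.
(* Starting [esups] at index 1 matches the range [0 < n] of the supremum. *)
have := measurable_fun_esups mu 1%N measurableT (emeasurable_itv `[0%E, +oo[).
congr (measurable _); rewrite setTI; apply/seteqP; split => x /=.
  by rewrite in_itv/= andbT.
by rewrite /crossing_event /= => ?; rewrite in_itv/= andbT.
Qed.

Let step (y : R) := expR (s * (y - mean Y) - phi s).

Let measurable_step : measurable_fun setT step.
Proof.
apply: measurableT_comp => //; apply: measurable_funB => //.
by apply: measurable_funM => //; exact: measurable_funB.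
Qed.

Let integral_step i : (\int[P]_x (step (Ys i x))%:E = 1)%E.
Proof.
rewrite integral_identically_distributed//; last by move=> y; exact: expR_ge0.
have iZ := mgf_domain_integrable_centered Js.
have iS := rintegrableZ (expR (- phi s)) iZ.
transitivity (\int[P]_x (expR (- phi s) * expR (s * (Y x - mean Y)))%:E)%E.
  by apply: eq_integral => x _; rewrite /step -expRD addrC.
rewrite -(fineK (integrable_fin_num measurableT iS)); congr EFin.
rewrite -[LHS]/(\int[P]_x (expR (- phi s) * expR (s * (Y x - mean Y)))).
rewrite (RintegralZl _ measurableT iZ) -(expR_cgf lo0 hi0 Js) expRN mulVf//.
by rewrite gt_eqF// expR_gt0.
Qed.

Lemma prod_stepE n x : \prod_(i < n) step (Ys i x) =
  expR (s * X n x - phi s * n%:R).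
Proof.
elim: n => [|n IH].
  by rewrite big_ord0 /X /centered_sum big_ord0 !mulr0 subrr expR0.
rewrite big_ord_recr /= IH /step -expRD /X /centered_sum big_ord_recr /=.
by congr expR; rewrite -natr1; ring.
Qed.

Lemma crossing_bound :
  (P crossing_event <= ((expR (phi s - eps * s)) ^+ m)%:E)%E.
Proof.
set q := expR (phi s - eps * s) ^+ m.
have q0 : 0 < q by rewrite exprn_gt0// expR_gt0.
have qE : q = expR (m%:R * (phi s - eps * s)) by rewrite /q -expRM_natl mulr_natl.
(* The supremum need not be attained: only the levels [exp (- r) / q] with
   [r > 0] are certainly crossed. *)
have step_bound r : 0 < r -> (P crossing_event <= (q * expR r)%:E)%E.
  move=> r0; set c := expR (m%:R * (s * eps - phi s) - r).
  have -> : q * expR r = c^-1.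
    by rewrite qE -expRD /c -expRN; congr expR; ring.
  apply: (@ville_ge _ _ _ _ Ys step c) => //.
  - by move=> y; exact: expR_ge0.
  - exact: expR_gt0.
  - exact: measurable_crossing_event.
  move=> x; rewrite /crossing_event /= => sup0.
  have : ((- r)%:E < ereal_sup [set (s * (X n x - m%:R * eps) -
      phi s * (n%:R - m%:R))%:E | n in [set n : nat | (0 < n)%N]])%E.
    by apply: lt_le_trans sup0; rewrite lte_fin oppr_lt0.
  move=> /ereal_sup_gt[_ [n n0 <-]]; rewrite lte_fin => rn; exists n.
  by rewrite prod_stepE /c ler_expR; lra.
have Pfin : P crossing_event \is a fin_num.
  by apply: fin_num_measure; exact: measurable_crossing_event.
move: step_bound; rewrite -(fineK Pfin); set p := fine _ => step_bound.
rewrite lee_fin leNgt; apply/negP => qp.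
have pq1 : 1 < p / q by rewrite ltr_pdivlMr// mul1r.
(* If [p > q], this [r] gives [p <= q * sqrt (p / q)], which is less than [p]. *)
have := step_bound (ln (p / q) / 2).
rewrite divr_gt0 ?ln_gt0// => /(_ isT); rewrite lee_fin => pe.
have lt2 : expR (ln (p / q) / 2) < p / q.
  rewrite -[X in _ < X]lnK ?posrE ?(lt_trans _ pq1)// ltr_expR.
  by have := ln_gt0 pq1; lra.
by move: lt2; rewrite ltr_pdivlMr// mulrC ltNge pe.
Qed.

End CrossingBound.

(** * The root of [phi' = eps]: existence, uniqueness and behaviour near 0 *)

Section CgfOfVariable.
Context (d : measure_display) (T : measurableType d) (R : realType)
  (P : probability T R) (Y : {RV P >-> R}).
Hypotheses (lo0 : (mgf_lo Y < 0)%E) (hi0 : (0 < mgf_hi Y)%E) (sd0 : 0 < sd Y).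

Let phi := cgf Y.
Let J := mgf_domain Y.
Let mZ := measurable_centered Y.
Let eZ := @mgf_domain_integrable_centered _ _ _ _ Y.
Let oJ := @mgf_domain_open _ _ _ _ Y.
Let J0 := mgf_domain0 lo0 hi0.
Let Z0 := Rintegral_centered lo0 hi0.

(** The mean of [Y - mean Y] under the law tilted by [exp (u Y)]. *)
Definition cgf_derivative (u : R) : R :=
  (\int[P]_x ((Y x - mean Y) * expR (u * (Y x - mean Y)))) /
  \int[P]_x expR (u * (Y x - mean Y)).

Lemma cgf_is_derive u : J u -> is_derive u 1 phi (cgf_derivative u).
Proof. exact: (is_derive_cgf mZ eZ oJ J0 Z0). Qed.

Lemma cgf_derivativeP u e : J u -> is_derive u 1 phi e -> cgf_derivative u = e.
Proof.
move=> Ju du; have du' := cgf_is_derive Ju.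
by rewrite -(@derive_val _ _ _ _ _ _ _ du') (@derive_val _ _ _ _ _ _ _ du).
Qed.

Lemma cgf_derivative_lt u v : J u -> J v -> u < v ->
  cgf_derivative u < cgf_derivative v.
Proof.
apply: (cgf_derivative_increasing mZ eZ oJ J0 Z0).
by rewrite -sqr_sd// exprn_gt0.
Qed.

Lemma cgf_derivative_inj u v : J u -> J v ->
  cgf_derivative u = cgf_derivative v -> u = v.
Proof.
move=> Ju Jv uv; apply/eqP; rewrite eq_le !leNgt; apply/andP; split.
  by apply/negP => /(cgf_derivative_lt Jv Ju); rewrite uv ltxx.
by apply/negP => /(cgf_derivative_lt Ju Jv); rewrite uv ltxx.
Qed.

Lemma cgf0 : phi 0 = 0.
Proof.
apply: expR_inj.
by rewrite expR_cgf// (mgf0 P (fun x => Y x - mean Y)) expR0.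
Qed.

Lemma cgf_derivative0 : cgf_derivative 0 = 0.
Proof.
rewrite /cgf_derivative.
under eq_Rintegral do rewrite mul0r expR0 mulr1.
by rewrite Z0 mul0r.
Qed.

Lemma cgf_derivative_root (eps : R) (la lb : \bar R) :
  (fun s => (phi s / s)%:E) @ right_of (mgf_lo Y) --> la -> (la < eps%:E)%E ->
  (fun s => (phi s / s)%:E) @ left_of (mgf_hi Y) --> lb -> (eps%:E < lb)%E ->
  exists2 z, J z & cgf_derivative z = eps.
Proof.
move=> /(right_of_exists lo0)/[apply]-[s [las s0 fs]].
move=> /(left_of_exists hi0)/[apply]-[t [tlb t0 ft]].
have Jst x : s <= x <= t -> J x.
  move=> /andP[sx xt]; split.
    by apply: (lt_le_trans las); rewrite lee_fin.
  by apply: le_lt_trans tlb; rewrite lee_fin.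
pose g u := phi u - eps * u.
have dg x : s <= x <= t -> is_derive x 1 g (cgf_derivative x - eps).
  move=> /Jst /cgf_is_derive dx; apply: is_derive_eq.
  by rewrite /GRing.scale /= mulr1.
(* As [s < 0], clearing the denominator of [phi s / s < eps] reverses the inequality. *)
have gs : g 0 < g s.
  by rewrite /g cgf0 mulr0 subrr subr_gt0 -ltr_ndivrMr.
have gt : g 0 < g t.
  by rewrite /g cgf0 mulr0 subrr subr_gt0 -ltr_pdivlMr.
have [|z /andP[sz zt] dz] := interior_critical_point _ dg gs gt.
  by rewrite s0 t0.
exists z; first by apply: Jst; rewrite !ltW.
by apply/eqP; rewrite -subr_eq0 dz.
Qed.

(** Continuity of the inverse of an increasing function: once [x] lies between the derivatives at
    [- r] and [r], monotonicity traps [zeta x] in [[- r, r]]. *)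
Lemma cgf_root_cvg0 (zeta : R -> R) :
  (\forall e \near (0 : R), J (zeta e) /\ cgf_derivative (zeta e) = e) ->
  zeta x @[x --> (0 : R)] --> (0 : R).
Proof.
move=> zE; apply/cvgrPdist_le => e e0.
have [e1 e10 Je1] := oJ J0.
pose r := Order.min e e1.
have r0 : 0 < r by rewrite lt_min e0 e10.
have Jr : J r by apply: Je1; rewrite subr0 gtr0_norm// ge_min lexx orbT.
have JNr : J (- r).
  by apply: Je1; rewrite subr0 normrN gtr0_norm// ge_min lexx orbT.
have up : 0 < cgf_derivative r.
  by rewrite -cgf_derivative0; exact: cgf_derivative_lt.
have lo : cgf_derivative (- r) < 0.
  by rewrite -cgf_derivative0; apply: cgf_derivative_lt; rewrite ?oppr_lt0.
near=> x.
have [Jx zx] : J (zeta x) /\ cgf_derivative (zeta x) = x by near: x; exact: zE.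
have xup : x < cgf_derivative r by near: x; exact: lt_nbhsl.
have xlo : cgf_derivative (- r) < x by near: x; exact: lt_nbhsr.
rewrite sub0r normrN; apply: (@le_trans _ _ r); last by rewrite ge_min lexx.
rewrite ler_norml !leNgt; apply/andP; split; apply/negP => zr.
  by have := lt_trans (cgf_derivative_lt Jx JNr zr) xlo; rewrite zx ltxx.
by have := lt_trans xup (cgf_derivative_lt Jr Jx zr); rewrite zx ltxx.
Unshelve. all: by end_near. Qed.

Lemma cgf_taylor : vanishes_to_order 4 (fun s =>
  phi s - (sd Y ^+ 2 / 2 * s ^+ 2 + third_cmoment Y / 6 * s ^+ 3)).
Proof. by rewrite sqr_sd//; exact: (cgf_expansion mZ eZ oJ J0 Z0). Qed.

Lemma cgf_derivative_taylor : vanishes_to_order 3 (fun s =>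
  cgf_derivative s - (sd Y ^+ 2 * s + third_cmoment Y / 2 * s ^+ 2)).
Proof. by rewrite sqr_sd//; exact: (cgf_derivative_expansion mZ eZ oJ J0 Z0). Qed.

End CgfOfVariable.

(** * Assembly of (i), (ii) and (iii) *)

Unset Implicit Arguments.

Theorem theorem14 (d : measure_display) (T : measurableType d) (R : realType)
  (P : probability T R) (Y : {RV P >-> R}) (Ys : nat -> {RV P >-> R}) :
  mutually_independent_rv Ys ->
  (forall i, identically_distributed (Ys i) Y) ->
  (mgf_lo Y < 0)%E -> (0 < mgf_hi Y)%E ->
  0 < sd Y ->
  let a := mgf_lo Y in let b := mgf_hi Y in
  let mu := mean Y in let sigma := sd Y in let nu := third_cmoment Y in
  let phi := cgf Y in let F0 : set_system R := (0 : R)^' in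
  let X := centered_sum Ys mu in
  forall m : nat, (0 < m)%N ->
  (forall eps : R,
     (exists la : \bar R,
        (fun s => (phi s / s)%:E) @ right_of a --> la /\ (la < eps%:E)%E) ->
     (exists lb : \bar R,
        (fun s => (phi s / s)%:E) @ left_of b --> lb /\ (eps%:E < lb)%E) ->
     (* (i) *)
     (forall s : R, (a < s%:E)%E -> (s%:E < b)%E ->
        (P [set x | (0 <= ereal_sup
             [set (s * (X n x - m%:R * eps) - phi s * (n%:R - m%:R))%:E
             | n in [set n : nat | (0 < n)%N]])%E]
         <= ((expR (phi s - eps * s)) ^+ m)%:E)%E)
     /\
     (* (ii) *)
     (exists zeta : R,
        [/\ (a < zeta%:E)%E, (zeta%:E < b)%E, is_derive zeta 1 phi eps,
            (forall s : R, (a < s%:E)%E -> (s%:E < b)%E ->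
               is_derive s 1 phi eps -> s = zeta) &
            (P [set x | (0 <= ereal_sup
                 [set (zeta * (X n x - m%:R * eps) - phi zeta * (n%:R - m%:R))%:E
                 | n in [set n : nat | (0 < n)%N]])%E]
             <= ((expR (phi zeta - eps * zeta)) ^+ m)%:E)%E]))
  /\
  (* (iii) : zeta(eps) is the root of phi' = eps in (a,b), for eps near 0 *)
  (forall zeta : R -> R,
     (\forall e \near (0 : R), (a < (zeta e)%:E)%E /\ ((zeta e)%:E < b)%E /\
                              is_derive (zeta e) 1 phi e) ->
     [/\ (exists h : R -> R, h =O_F0 (fun e => e ^+ 4) /\
            \forall e \near (0 : R)^',
              (expR (phi (zeta e) - e * zeta e)) ^+ m =
              (1 + h e) * (expR (- (e ^+ 2) / (2 * sigma ^+ 2)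
                                 + nu * e ^+ 3 / (6 * sigma ^+ 6))) ^+ m),
         (exists h : R -> R, h =O_F0 (fun e => e ^+ 3) /\
            \forall e \near (0 : R)^',
              (expR (phi (zeta e) - e * zeta e)) ^+ m =
              (1 + h e) * (expR (- (e ^+ 2) / (2 * sigma ^+ 2))) ^+ m),
         (exists h : R -> R, h =O_F0 (fun e => e ^+ 2) /\
            \forall e \near (0 : R)^',
              phi (zeta e) / zeta e =
              e / 2 * (1 - nu * e / (6 * sigma ^+ 4) + h e)) &
         (exists h : R -> R, h =O_F0 (fun e => e) /\
            \forall e \near (0 : R)^',
              phi (zeta e) / zeta e = e / 2 * (1 + h e))]).
Proof.
move=> indep ident lo0 hi0 sd0 a b mu sigma nu phi F0 X m m0; split.
  move=> eps [la [lacv laeps]] [lb [lbcv epslb]]; split.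
    by move=> s las slb; apply: crossing_bound.
  have [z [az zb] dz] := cgf_derivative_root lo0 hi0 lacv laeps lbcv epslb.
  exists z; split=> //.
  - by rewrite -dz; exact: cgf_is_derive.
  - move=> s las slb ds; apply: (cgf_derivative_inj lo0 hi0 sd0) => //.
    by rewrite dz; exact: cgf_derivativeP.
  - exact: crossing_bound.
move=> zeta zetaE.
have zE : \forall e \near (0 : R),
    mgf_domain Y (zeta e) /\ cgf_derivative Y (zeta e) = e.
  apply: filterS zetaE => e [az [zb dz]].
  by have Jz : mgf_domain Y (zeta e); split => //; exact: cgf_derivativeP.
have zcv := cgf_root_cvg0 lo0 hi0 sd0 zE.
have zroot : \forall e \near (0 : R), cgf_derivative Y (zeta e) = e.
  by apply: filterS zE => e [].
have v0 : 0 < sigma ^+ 2 by rewrite exprn_gt0.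
have phiE := cgf_taylor lo0 hi0 sd0.
have dphiE := cgf_derivative_taylor lo0 hi0 sd0.
have AO := legendre_expansion v0 phiE dphiE zcv zroot.
have [r rO rE] := ratio_expansion v0 phiE dphiE zcv zroot.
have expand k (B : R -> R) :
    vanishes_to_order k.+1 (fun e => phi (zeta e) - e * zeta e - B e) ->
    exists h : R -> R, h =O_F0 (fun e => e ^+ k.+1) /\
      \forall e \near (0 : R)^', expR (phi (zeta e) - e * zeta e) ^+ m =
        (1 + h e) * expR (B e) ^+ m.
  move=> BO.
  (* [1 + h] is the exact quotient of the two [m]-th powers. *)
  exists (fun e => expR (m%:R * (phi (zeta e) - e * zeta e - B e)) - 1).
  split; first exact/vanishes_bigO/vanishes_expRB1/vanishesZ.
  near=> e; rewrite [1 + _]addrC subrK.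
  rewrite -(expRM_natl m (phi _ - _)) -(expRM_natl m (B e)) -expRD.
  by congr expR; ring.
split.
- by apply: expand; apply: vanishes_eqfun AO => e; rewrite -exprM.
(* The cubic term is moved into the error, which drops to order 3; the last item does the same with
   the linear term of the ratio. *)
- apply: expand.
  have := vanishesD (vanishesW (isT : (3 <= 4)%N) AO)
    (vanishesZ (nu / (6 * sigma ^+ 6)) (vanishesX R 3)).
  by apply: vanishes_eqfun => e; rewrite -exprM -/phi -/nu; ring.
- exists r; split; first exact: vanishes_bigO.
  by apply: filterS rE => e ->; rewrite -exprM.
- exists (fun e => - (nu / (6 * sigma ^+ 4)) * e + r e); split.
    exact: (vanishes_bigO (vanishesD
      (vanishesZ (- (nu / (6 * sigma ^+ 4))) (vanishes_id R))
      (vanishesW (isT : (1 <= 2)%N) rO))).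
  by apply: filterS rE => e ->; rewrite -exprM -/nu; congr (_ * _); ring.
Unshelve. all: by end_near. Qed.
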